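(* For all $\lambda\ge 0$ and $\sigma\ge 0$, $$\lim_{N\to\infty}\frac{1}{2N}\log Z_N(\lambda,\sigma)=\max\big(F(\lambda),G(\sigma)\big).$$ More precisely, there exists a constant $C_1(\lambda,\sigma)>0$ such that: (1) if $G(\sigma)>F(\lambda)$, then for all $N\ge 1$, $$\frac{1}{C_1(\lambda,\sigma)}\le \frac{\sqrt N\, Z_N(\lambda,\sigma)}{\exp(2N G(\sigma))}\le C_1(\lambda,\sigma);$$ (2) if $G(\sigma)\le F(\lambda)$ and $\lambda>2$, then for all $N\ge 1$, $$\frac{1}{C_1(\lambda,\sigma)}\le \frac{Z_N(\lambda,\sigma)}{\exp(2N F(\lambda))}\le C_1(\lambda,\sigma).$$
   Context: For $N\ge1$ let $\Omega_N=\{\xi\in\mathbb Z_+^{2N+1}:\ \xi_0=\xi_{2N}=0,\ |\xi_x-\xi_{x-1}|=1\ \text{for all } x\in\{1,\dots,2N\}\}$, where $\mathbb Z_+=\{0,1,2,\dots\}$ and $\xi=(\xi_0,\dots,\xi_{2N})$. Set $H(\xi)=\#\{x\in\{1,\dots,2N-1\}:\xi_x=0\}$ and $A(\xi)=\sum_{x=1}^{2N}\xi_x$. For $\lambda\ge0$, $\sigma\in\mathbb R$, $$Z_N(\lambda,\sigma)=2^{-2N}\sum_{\xi\in\Omega_N}\lambda^{H(\xi)}\exp\big(\tfrac{\sigma}{N}A(\xi)\big),$$ with the convention $0^0=1$ and $0^k=0$ for $k\ge1$. The functions $F,G$ are $F(\lambda)=\log\big(\frac{\lambda}{2\sqrt{\lambda-1}}\big)$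 if $\lambda>2$, $F(\lambda)=0$ if $0\le\lambda\le2$, and $G(\sigma)=\int_0^1\log\cosh(\sigma(1-2x))\,dx$. *)

(* Defs.v *)
From mathcomp Require Import all_boot all_order all_algebra.
From mathcomp Require Import zify.
From mathcomp Require Import all_classical all_reals all_analysis.
Set Implicit Arguments.
Unset Strict Implicit.
Unset Printing Implicit Defensive.
Import Order.TTheory GRing.Theory Num.Theory.
Import numFieldNormedType.Exports.
Local Open Scope classical_set_scope.
Local Open Scope ring_scope.

(* The path xi = (xi_0, ..., xi_{2N}) is a tuple of naturals; xi_x is
   [nth 0 xi x], so the default value is never reached for x <= 2N. *)
Definition Omega (N : nat) : set ((2 * N).+1.-tuple nat) :=
  [set xi | nth 0%N xi 0 = 0%N /\ nth 0%N xi (2 * N) = 0%N /\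
    forall x : nat, (1 <= x <= 2 * N)%N ->
      `|(nth 0%N xi x)%:Z - (nth 0%N xi x.-1)%:Z| = 1].
Arguments Omega : clear implicits.

Definition contacts (N : nat) (xi : (2 * N).+1.-tuple nat) : nat :=
  (\sum_(1 <= x < 2 * N | nth 0%N xi x == 0%N) 1)%N.

Definition area (N : nat) (xi : (2 * N).+1.-tuple nat) : nat :=
  (\sum_(1 <= x < (2 * N).+1) nth 0%N xi x)%N.

(* The sum over the set [Omega N] is a finitely supported sum, which the
   library sets to 0 on infinite supports; this lemma rules that case out. *)
Lemma finite_Omega (N : nat) : finite_set (Omega N).
Proof.
have nth_le (xi : (2 * N).+1.-tuple nat) : Omega N xi ->
    forall x, (x <= 2 * N)%N -> (nth 0%N xi x <= x)%N.
  move=> [xi0 [_ step]]; elim=> [|x IHx] lexN; first by rewrite xi0.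
  have := step x.+1; rewrite /= lexN => /(_ isT).
  have := IHx (ltnW lexN); lia.
pose f (t : (2 * N).+1.-tuple 'I_(2 * N).+1) : (2 * N).+1.-tuple nat :=
  [tuple of map val t].
apply: (@sub_finite_set _ _ (f @` setT)); last first.
  by apply: finite_image; exact: finite_finset.
move=> xi Oxi; exists [tuple inord (nth 0%N xi i) | i < (2 * N).+1] => //.
apply: eq_from_tnth => i; rewrite tnth_map tnth_mktuple (tnth_nth 0%N) /=.
have lei : (i <= 2 * N)%N by rewrite -ltnS.
by rewrite inordK // ltnS (leq_trans (nth_le _ Oxi _ lei)).
Qed.

Section Partition.
Variable R : realType.
Implicit Types lambda sigma x : R.

(* [0 ^+ 0 = 1] and [0 ^+ k.+1 = 0], as the convention on powers of 0
   requires. *)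
Definition Z (N : nat) lambda sigma : R :=
  2 ^- (2 * N) * \sum_(xi \in Omega N)
    (lambda ^+ contacts xi * expR (sigma / N%:R * (area xi)%:R)).

Definition cosh x : R := (expR x + expR (- x)) / 2.

Definition F lambda : R :=
  if 2 < lambda then ln (lambda / (2 * Num.sqrt (lambda - 1))) else 0.

Definition G sigma : R :=
  \int[lebesgue_measure]_(x in `[0, 1]) ln (cosh (sigma * (1 - 2 * x))).

End Partition.

(* Main.v *)
Require Import Defs.
From mathcomp Require Import all_boot all_order all_algebra.
From mathcomp Require Import all_classical all_reals all_analysis.
From mathcomp Require Import ring lra zify.
Import Order.TTheory GRing.Theory Num.Theory.
Import numFieldNormedType.Exports.
Set Implicit Arguments.
Unset Strict Implicit.
Unset Printing Implicit Defensive.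
Local Open Scope classical_set_scope.
Local Open Scope ring_scope.

(** Put s = sigma / N. A path is cut at its visits to 0 into excursions, and
    the weights K(j) of the excursions of length j, each with its own factor
    exp (s area), determine Z_N through a renewal equation.

    _One excursion._ As the increments of an excursion of length 2 m add up to
    0, its area is the sum of its increments weighted by their signed distance to
    the midpoint; so the factor exp (s area) is a product of one factor per
    step, and normalising each step costs the product of the cosh (h_i), where
    h_i = s (m - i - 1/2). This product squared is exp (2 m G) up to a constant
    when s m = sigma, by the midpoint rule ([G_midpoint]). What remains is a
    walk with independent steps in the fields h_i, killed at 0. The first half
    of an excursion and the time reversal of the second half are two copies of
    this walk, so that K(2 m) is the square norm of the law of the killed walk
    at time m ([excursion_square]). This square norm has order m^(-1/2):
    Nash's inequality bounds it from above ([kwalk_energy_le]); from below, the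
    fields drive the walk away from 0, so that it survives with positive
    probability ([kwalk_survival]) and, its variance being at most m, sits in a
    window of width m^(1/2), to which Cauchy-Schwarz applies
    ([excursion_ge]). This lower bound for K(2 N) is the one for Z_N when
    G > F.

    _Upper bounds._ Convexity of ln cosh gives K(j) <= C exp (j (j / 2 N) G),
    so that an excursion covering a fraction t of the path has the rate t G per
    step: intermediate lengths are exponentially unlikely compared to both
    short and nearly full lengths. For short excursions the area is
    negligible, and without area F(lambda) is exactly the rate at which lambda K
    becomes a (sub)probability ([sum_excursions_le1]). The renewal equation
    then bounds Z_N by C exp (2 N Gam) + C B exp (2 N g) for all rates Gam >= F
    and g >= G with Gam <= g < 2 Gam, B being the prefactor of the long
    excursions ([partition_le]): take F < Gam < G = g and B of order N^(-1/2)
    when F < G, and Gam = g = F, B = 1 when G <= F.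

    _Lower bound in the pinned phase._ For lambda > 2 and without area, the
    transfer operator has the eigenfunction r^y, r = (lambda - 1)^(-1/2), of
    eigenvalue exp F, which is square summable; cutting the path at its middle
    and using Cauchy-Schwarz once more gives Z_N >= c exp (2 N F)
    ([pinned_ge]).

    The limit follows from these bounds, except when lambda <= 2 and
    sigma = 0, where both rates vanish and polynomial bounds are enough
    ([critical_rate]). *)

(** * The function ln cosh *)

Section HyperbolicCosine.
Variable R : realType.
Implicit Types a d h t x y : R.

Lemma cosh_gt0 x : 0 < cosh x.
Proof. by rewrite /cosh; have := expR_gt0 x; have := expR_gt0 (- x); lra. Qed.

Lemma coshN x : cosh (- x) = cosh x.
Proof. by rewrite /cosh opprK addrC. Qed.

Lemma cosh0 : cosh 0 = 1 :> R.
Proof. by rewrite /cosh oppr0 expR0; lra. Qed.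

(** Convexity of ln cosh in the form used for changes of measure: the slope t
    is tanh a, and the inequality is Jensen's for a step of mean t. *)
Lemma cosh_tangent a : exists2 t : R, `|t| <= 1 &
  forall d, cosh a * expR (t * d) <= cosh (a + d).
Proof.
pose t := (expR a - expR (- a)) / (expR a + expR (- a)).
have ea := expR_gt0 a; have eNa := expR_gt0 (- a).
have s_gt0 : 0 < expR a + expR (- a) by lra.
exists t.
  rewrite /t normrM normfV (gtr0_norm s_gt0) ler_pdivrMr// mul1r ler_norml.
  by apply/andP; split; lra.
move=> d; rewrite /cosh opprD !expRD.
(* Jensen: [expR u >= expR v * (1 + (u - v))], for [u = d] and [u = - d] *)
have key (u v : R) : expR v * (1 + (u - v)) <= expR u.
  rewrite -[u in leRHS](subrK v) [in leRHS]addrC expRD ler_pM2l ?expR_gt0//.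
  exact: expR_ge1Dx.
have H1 := key d (t * d); have H2 := key (- d) (t * d).
have tE : t * (expR a + expR (- a)) = expR a - expR (- a).
  by rewrite /t mulfVK// gt_eqF.
have {}H1 : expR a * (expR (t * d) * (1 + (d - t * d))) <= expR a * expR d.
  by rewrite ler_pM2l.
have {}H2 : expR (- a) * (expR (t * d) * (1 + (- d - t * d)))
            <= expR (- a) * expR (- d) by rewrite ler_pM2l.
have : expR a * (expR (t * d) * (1 + (d - t * d))) +
       expR (- a) * (expR (t * d) * (1 + (- d - t * d))) =
       (expR a + expR (- a)) * expR (t * d).
  transitivity (expR (t * d) * ((expR a + expR (- a))
    + d * (expR a - expR (- a)) - d * (t * (expR a + expR (- a))))); first by ring.
  by rewrite tE; ring.
lra.
Qed.

Lemma cosh_ge1 x : 1 <= cosh x.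
Proof.
rewrite /cosh expRN; have e := expR_gt0 x.
have : 0 <= (expR x - 1) ^+ 2 / expR x.
  by rewrite divr_ge0 ?sqr_ge0 ?expR_ge0.
have -> : (expR x - 1) ^+ 2 / expR x = expR x + (expR x)^-1 - 2.
  by field; rewrite gt_eqF.
lra.
Qed.

Lemma ln_cosh_ge0 x : 0 <= ln (cosh x).
Proof. exact/ln_ge0/cosh_ge1. Qed.

Lemma ln_cosh_tangent a : exists2 t : R, `|t| <= 1 &
  forall x, ln (cosh a) + t * (x - a) <= ln (cosh x).
Proof.
have [t t1 H] := cosh_tangent a; exists t => // x.
have := H (x - a); rewrite [a + _]addrC subrK.
have ca := cosh_gt0 a; have cx := cosh_gt0 x.
have et := expR_gt0 (t * (x - a)); have p := mulr_gt0 ca et.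
by rewrite -ler_ln ?posrE// lnM ?posrE// expRK.
Qed.

Lemma ln_cosh_lipschitz x y : ln (cosh x) - ln (cosh y) <= `|x - y|.
Proof.
have [t t1 H] := ln_cosh_tangent x.
have := H y; have : t * (x - y) <= `|x - y|.
  apply: le_trans (ler_norm _) _; rewrite normrM -[leRHS]mul1r.
  by rewrite ler_wpM2r.
have -> : t * (y - x) = - (t * (x - y)) by ring.
lra.
Qed.

Lemma ln_cosh_scale t y : 0 <= t <= 1 -> ln (cosh (t * y)) <= t * ln (cosh y).
Proof.
move=> /andP[t0 t1]; have [u _ H] := ln_cosh_tangent (t * y).
have := H 0; rewrite cosh0 ln1 => H0.
have := ler_wpM2l t0 (H y); have : (1 - t) * (ln (cosh (t * y)) + u * (0 - t * y)) <= 0.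
  by rewrite mulr_ge0_le0//; lra.
nra.
Qed.

Lemma cosh_sub_le h t : 0 <= h -> 0 <= t -> cosh (h - t) <= cosh h * cosh t.
Proof.
move=> h0 t0; rewrite /cosh !opprD opprK !expRD.
have e (x : R) : 0 <= x -> expR (- x) <= expR x by move=> x0; rewrite ler_expR; lra.
have := mulr_ge0 (_ : 0 <= expR h - expR (- h)) (_ : 0 <= expR t - expR (- t)).
by rewrite !subr_ge0 => /(_ (e _ h0) (e _ t0)); nra.
Qed.

Lemma cosh_sub_ge h t : 0 <= t <= h -> cosh (h - t) * cosh t <= cosh h.
Proof.
move=> /andP[t0 th]; rewrite -{2}[h](subrK t); move: (h - t) (subr_ge0 t h) => u.
rewrite th => /idP u0; rewrite /cosh !opprD !expRD.
have e (x : R) : 0 <= x -> expR (- x) <= expR x by move=> x0; rewrite ler_expR; lra.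
have := mulr_ge0 (_ : 0 <= expR u - expR (- u)) (_ : 0 <= expR t - expR (- t)).
by rewrite !subr_ge0 => /(_ (e _ u0) (e _ t0)); nra.
Qed.

Lemma ler_cosh x y : `|x| <= y -> cosh x <= cosh y.
Proof.
rewrite ler_norml => /andP[x0 x1].
have y0 : 0 <= y by lra.
have -> : cosh x = cosh `|x|.
  by case: (ger0P x) => // _; rewrite coshN.
set z := `|x|; have z0 : 0 <= z by exact: normr_ge0.
have zy : z <= y by rewrite /z ler_norml x0 x1.
have /cosh_sub_ge H : 0 <= y - z <= y by apply/andP; split; lra.
rewrite subKr in H; apply: le_trans H.
by rewrite ler_peMr ?cosh_ge1// ltW ?cosh_gt0.
Qed.

End HyperbolicCosine.

(** * Inequalities for finite sums and for recursions *)

Section Inequalities.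
Variable R : realType.

Lemma weighted_cauchy_schwarz (n : nat) (a x y : nat -> R) :
  (forall i, 0 <= a i) ->
  (\sum_(i < n) a i * x i * y i) ^+ 2
    <= (\sum_(i < n) a i * x i ^+ 2) * (\sum_(i < n) a i * y i ^+ 2).
Proof.
move=> a0.
set P := \sum_(i < n) a i * x i * y i.
set Q := \sum_(i < n) a i * x i ^+ 2; set S := \sum_(i < n) a i * y i ^+ 2.
have quad (u v : R) : 0 <= u ^+ 2 * Q - 2 * u * v * P + v ^+ 2 * S.
  have -> : u ^+ 2 * Q - 2 * u * v * P + v ^+ 2 * S =
      \sum_(i < n) a i * (u * x i - v * y i) ^+ 2.
    rewrite /P /Q /S !mulr_sumr -sumrN -!big_split /=.
    by apply: eq_bigr => i _; ring.
  by apply: sumr_ge0 => i _; rewrite mulr_ge0 ?sqr_ge0.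
have Q0 : 0 <= Q by apply: sumr_ge0 => i _; rewrite mulr_ge0 ?sqr_ge0.
have S0 : 0 <= S by apply: sumr_ge0 => i _; rewrite mulr_ge0 ?sqr_ge0.
have [Q_gt0|Q_le0] := ltP 0 Q.
  have := quad P Q; have -> : P ^+ 2 * Q - 2 * P * Q * P + Q ^+ 2 * S
    = Q * (Q * S - P ^+ 2) by ring.
  by rewrite pmulr_rge0// subr_ge0.
have Q00 : Q = 0 by lra.
have := quad (S + 1) P; rewrite Q00; nra.
Qed.

Lemma sum_geometric_le (c : R) (n : nat) : 0 < c ->
  \sum_(i < n) expR (- (c * i.+1%:R)) <= c^-1.
Proof.
move=> c0; suff : \sum_(i < n) expR (- (c * i.+1%:R)) <=
    c^-1 * (1 - expR (- (c * n%:R))).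
  move/le_trans; apply; rewrite ler_piMr ?invr_ge0 ?ltW//.
  by have := expR_gt0 (- (c * n%:R)); lra.
elim: n => [|n IHn]; first by rewrite big_ord0 mulr0 oppr0 expR0 subrr mulr0.
rewrite big_ord_recr /=; apply: le_trans (lerD IHn (lexx _)) _.
have cV : c^-1 * c = 1 by rewrite mulVf ?gt_eqF.
rewrite -subr_ge0.
have -> : expR (- (c * n%:R)) = expR (- (c * n.+1%:R)) * expR c.
  by rewrite -expRD -natr1; congr expR; ring.
set e := expR (- _); have e0 : 0 < e by exact: expR_gt0.
have -> : c^-1 * (1 - e) - (c^-1 * (1 - e * expR c) + e) =
  e * (c^-1 * (expR c - (1 + c)) + (c^-1 * c - 1)) by ring.
rewrite cV subrr addr0 !mulr_ge0 ?invr_ge0 ?(ltW e0) ?(ltW c0)//.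
by rewrite subr_ge0 expR_ge1Dx.
Qed.

(** A discrete Gronwall inequality in terms of the running maximum M of x: the
    maximum grows by a factor 1 + e and an increment r k at each step. *)
Lemma discrete_gronwall (T : nat) (e : R) (x r : nat -> R) : 0 <= e ->
  (forall k, 0 <= r k) ->
  (forall k M, (k < T)%N -> 0 <= M -> (forall m, (m < k)%N -> x m <= M) ->
     x k <= (1 + e) * M + r k) ->
  forall k, (k < T)%N -> x k <= (1 + e) ^+ k.+1 * \sum_(m < k.+1) r m.
Proof.
move=> e0 r0 H.
have e1 : 1 <= 1 + e by lra.
have mono k k' : (k <= k')%N ->
    (1 + e) ^+ k * \sum_(m < k) r m <= (1 + e) ^+ k' * \sum_(m < k') r m.
  move=> kk'; apply: ler_pM.
  - by rewrite exprn_ge0; lra.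
  - exact: sumr_ge0.
  - exact: ler_weXn2l.
  - rewrite -(subnKC kk') big_split_ord /= lerDl; exact: sumr_ge0.
move=> k; elim/ltn_ind: k => k IH kT.
apply: le_trans (H k ((1 + e) ^+ k * \sum_(m < k) r m) kT _ _) _.
- by rewrite mulr_ge0 ?exprn_ge0 ?sumr_ge0//; lra.
- by move=> m mk; apply: le_trans (IH m mk (ltn_trans mk kT)) (mono _ _ mk).
- rewrite big_ord_recr /= mulrDr mulrA -exprS lerD2l.
  rewrite ler_peMl// -[leLHS](expr1n _ k.+1).
  by apply: lerXn2r; rewrite ?nnegrE; lra.
Qed.

Lemma expR_ge1D_pow (D : R) (n : nat) : 0 <= D -> (0 < n)%N ->
  (1 + D / n%:R) ^+ n <= expR D.
Proof.
move=> D0 n0; have d0 : 0 <= D / n%:R by rewrite divr_ge0.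
have -> : expR D = expR (D / n%:R) ^+ n.
  by rewrite -expRM_natl mulrCA mulfV ?mulr1// pnatr_eq0 -lt0n.
apply: lerXn2r; rewrite ?nnegrE ?expR_ge0 ?expR_ge1Dx//; lra.
Qed.

End Inequalities.

(** * The transfer operator of the pinned path *)

Section Transfer.
Variable R : realType.
Implicit Types (lam s : R) (f phi U D : nat -> R) (k l y z M : nat).

(** U and D are indexed by the height which the step up or down leaves. *)
Definition transfer U D f y : R :=
  (if y is z.+1 then U z * f z else 0) + D y.+1 * f y.+1.

(** The forward and backward equations: a test function can be averaged over
    one step instead of moving the mass. Masses, moments and eigenfunctions are
    followed in time by choices of phi. *)
Lemma transfer_adjoint U D f phi M : (forall y, (M <= y.+1)%N -> f y = 0) ->
  \sum_(y < M) phi y * transfer U D f y =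
  \sum_(z < M) f z * (U z * phi z.+1 + if (z : nat) is z'.+1 then D z * phi z' else 0).
Proof.
case: M => [|M] f0; first by rewrite !big_ord0.
under eq_bigr do rewrite mulrDr.
under [RHS]eq_bigr do rewrite mulrDr.
rewrite !big_split /=; congr (_ + _).
  rewrite big_ord_recl /= mulr0 add0r [RHS]big_ord_recr /= f0// mul0r addr0.
  by apply: eq_bigr => i _; rewrite /bump /= add1n; ring.
rewrite big_ord_recr /= f0// mulr0 mulr0 addr0 [RHS]big_ord_recl /= mulr0 add0r.
by apply: eq_bigr => i _; rewrite /bump /= add1n; ring.
Qed.

(** A contact is counted by the step that leaves 0, so that both endpoints of
    a path from 0 to 0 are left out if the first step is treated apart. *)
Definition leave lam z : R := if z == 0%N then lam else 1.

(** The area is distributed over the edges: a step between z and z + 1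
    contributes the mean height z + 1/2. For a path from 0 to 0 the total is
    the sum of the heights, and the edge weights are symmetric. *)
Definition up lam s z : R := leave lam z * (expR (s * (z%:R + 2^-1)) / 2).
Definition down lam s z : R := leave lam z * (expR (s * (z%:R - 2^-1)) / 2).

(** The weight of the nonnegative paths from 0 to y with k + 1 steps: the index
    0 is the first step, which carries no contact. For lam = 0 only the paths
    that do not return to 0 before their last step are left; in particular
    [pweight 0 s k 0] is the weight of the excursions of length k + 1. *)
Fixpoint pweight lam s k y : R :=
  if k is k'.+1 then transfer (up lam s) (down lam s) (pweight lam s k') y
  else if y == 1%N then expR (s / 2) / 2 else 0.

Lemma pweightS lam s k y : pweight lam s k.+1 y =
  transfer (up lam s) (down lam s) (pweight lam s k) y.
Proof. by []. Qed.

Lemma down_up lam s z : leave lam z * down lam s z.+1 = up lam s z.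
Proof.
rewrite /down /up {2}/leave /= mul1r; congr (_ * (expR (s * _) / 2)).
by rewrite -natr1; field.
Qed.

Lemma leaveS lam z : leave lam z.+1 = 1.
Proof. by []. Qed.

Lemma leave_ge0 lam z : 0 <= lam -> 0 <= leave lam z.
Proof. by rewrite /leave; case: ifP. Qed.

Lemma up_ge0 lam s z : 0 <= lam -> 0 <= up lam s z.
Proof. by move=> l0; rewrite !mulr_ge0 ?leave_ge0 ?expR_ge0 ?invr_ge0. Qed.

Lemma down_ge0 lam s z : 0 <= lam -> 0 <= down lam s z.
Proof. by move=> l0; rewrite !mulr_ge0 ?leave_ge0 ?expR_ge0 ?invr_ge0. Qed.

Lemma pweight_ge0 lam s k y : 0 <= lam -> 0 <= pweight lam s k y.
Proof.
move=> l0; elim: k y => [|k IHk] y /=.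
  by case: ifP => // _; rewrite divr_ge0 ?expR_ge0.
rewrite addr_ge0 ?mulr_ge0 ?down_ge0//.
by case: y => // z; rewrite mulr_ge0 ?up_ge0.
Qed.

Lemma pweight_supp lam s k y : (k.+1 < y)%N -> pweight lam s k y = 0.
Proof.
elim: k y => [|k IHk] y /=; first by case: eqP => // ->.
case: y => // y ky; rewrite /transfer !IHk ?mulr0 ?addr0//; lia.
Qed.

Lemma pweight_parity lam s k y : ~~ odd (k + y) -> pweight lam s k y = 0.
Proof.
elim: k y => [|k IHk] y /=; first by case: eqP => // ->.
rewrite /transfer => par; rewrite [pweight _ _ _ y.+1]IHk ?mulr0 ?addr0.
  by case: y par => // y par; rewrite IHk ?mulr0//; lia.
lia.
Qed.

(** Moving one step from one factor to the other costs nothing because the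
    edge weights are symmetric; in this way a path from 0 to 0 is cut at any
    intermediate time. *)
Lemma pweight_cut lam s k l M : ((k + l).+3 < M)%N ->
  pweight lam s (k + l).+1 0 =
  \sum_(y < M) leave lam y * pweight lam s k y * pweight lam s l y.
Proof.
elim: k l => [|k IHk] l klM.
  case: M klM => [|[|M]]// klM.
  rewrite big_ord_recl big_ord_recl big1 => [|i _] /=.
    rewrite addr0 mulr0 mul0r add0r /transfer add0r add0n /down /leave /= !mul1r.
    by congr (expR _ / 2 * _); field.
  by rewrite /bump /= mulr0 mul0r.
rewrite addSnnS IHk; last by lia.
symmetry; under eq_bigr do rewrite mulrAC.
rewrite (@transfer_adjoint _ _ _ (fun y => leave lam y * pweight lam s l y)).
  apply: eq_bigr => i _; move: (i : nat) => z {i}.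
  rewrite -[RHS]mulrA [RHS]mulrCA pweightS.
  congr (_ * _); rewrite /transfer [RHS]mulrDr addrC; congr (_ + _).
    by case: z => [|z]; rewrite ?mulr0// -down_up /= leaveS; ring.
  by rewrite -down_up leaveS; ring.
by move=> y My; apply: pweight_supp; lia.
Qed.

(** Decomposition at the last visit to 0. *)
Lemma pweight_renewal lam s k y : pweight lam s k y = pweight 0 s k y +
  lam * \sum_(m < k) pweight lam s m 0 * pweight 0 s (k - m.+1) y.
Proof.
elim: k y => [|k IHk] y; first by rewrite big_ord0 mulr0 addr0.
have leaveE z (x : R) : leave lam z * x = leave 0 z * x + (z == 0%N)%:R * (lam * x).
  by rewrite /leave; case: ifP => _ /=; ring.
have split_leave z (c : R) : leave lam z * c * pweight lam s k z =
    leave 0 z * c * pweight 0 s k z +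
    lam * (\sum_(m < k) pweight lam s m 0 * (leave 0 z * c * pweight 0 s (k - m.+1) z))
    + lam * pweight lam s k 0 * ((z == 0%N)%:R * c).
  rewrite leaveE mulrDl; congr (_ + _).
    under [X in lam * X]eq_bigr do rewrite mulrCA.
    by rewrite -mulr_sumr [pweight lam s k z]IHk; ring.
  by case: (z =P 0%N) => [->|_] /=; ring.
rewrite big_ord_recr /= subnn mulrDr mulrA addrA /transfer.
have -> : pweight 0 s 0 y = (if y is z.+1 then (z == 0%N)%:R *
    (expR (s * (z%:R + 2^-1)) / 2) else 0).
  case: y => [|[|y]] //=; rewrite ?mul0r// mul1r.
  by congr (expR _ / 2); rewrite add0r.
have sumE : \sum_(m < k) pweight lam s m 0 * pweight 0 s (k.+1 - m.+1) y =
    \sum_(m < k) pweight lam s m 0 *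
      transfer (up 0 s) (down 0 s) (pweight 0 s (k - m.+1)) y.
  apply: eq_bigr => -[m mk] _ /=; congr (_ * _).
  by have -> : (k.+1 - m.+1 = (k - m.+1).+1)%N by lia.
rewrite sumE /transfer /down !split_leave /=.
under [in RHS]eq_bigr do rewrite mulrDr.
rewrite [in RHS]big_split /=.
case: y {sumE} => [|y]; last by rewrite /up split_leave; ring.
by rewrite [X in _ = _ + lam * (X + _) + _]big1 => [|m _]; rewrite ?mulr0//; ring.
Qed.

Lemma ler_pweight lam lam' s s' k y : 0 <= lam <= lam' -> s <= s' ->
  pweight lam s k y <= pweight lam' s' k y.
Proof.
move=> /andP[l0 ll] ss.
have hle z : leave lam z <= leave lam' z by rewrite /leave; case: ifP.
have ele (x : R) : 0 <= x -> expR (s * x) / 2 <= expR (s' * x) / 2.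
  by move=> x0; rewrite ler_pM2r ?invr_gt0// ler_expR ler_wpM2r.
have e0 (x : R) : 0 <= expR x / 2 by rewrite divr_ge0 ?expR_ge0.
elim: k y => [|k IHk] y /=.
  by case: ifP => // _; apply: ele; rewrite invr_ge0.
apply: lerD.
  case: y => // y; apply: ler_pM; rewrite ?up_ge0 ?pweight_ge0//.
  by apply: ler_pM; rewrite ?leave_ge0// ele// addr_ge0 ?invr_ge0.
apply: ler_pM; rewrite ?down_ge0 ?pweight_ge0//.
apply: ler_pM; rewrite ?leave_ge0// ele// -natr1.
have := ler0n R y; lra.
Qed.

(** A path with [k + 1] steps has area at most [(k + 1)^2]. *)
Lemma pweight_area_le lam s k y : 0 <= lam -> 0 <= s ->
  pweight lam s k y <= expR (s * (k.+1%:R ^+ 2)) * pweight lam 0 k y.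
Proof.
move=> l0 s0; elim: k y => [|k IHk] y /=.
  case: ifP => _; rewrite ?mulr0// mul0r expR0 mul1r.
  by rewrite ler_pM2r ?invr_gt0// ler_expR expr1n; lra.
have step z (x : R) : (z <= k.+1)%N -> 0 <= x <= z%:R + 2^-1 ->
    leave lam z * (expR (s * x) / 2) * pweight lam s k z <=
    expR (s * k.+2%:R ^+ 2) * (leave lam z * (expR (0 * x) / 2) * pweight lam 0 k z).
  move=> zk /andP[x0 xz].
  have -> : expR (s * k.+2%:R ^+ 2) * (leave lam z * (expR (0 * x) / 2) * pweight lam 0 k z) =
    leave lam z * (expR (s * (k.+2%:R ^+ 2 - k.+1%:R ^+ 2)) / 2) *
    (expR (s * k.+1%:R ^+ 2) * pweight lam 0 k z).
    by rewrite mul0r expR0 mulrBr expRD expRN; field; rewrite gt_eqF ?expR_gt0.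
  apply: ler_pM; rewrite ?mulr_ge0 ?leave_ge0 ?expR_ge0 ?invr_ge0 ?pweight_ge0//.
  rewrite ler_wpM2l ?leave_ge0// ler_pM2r ?invr_gt0// ler_expR ler_wpM2l//.
  have : z%:R <= k.+1%:R :> R by rewrite ler_nat.
  have := ler0n R k; rewrite -!(natr1 k.+1) -(natr1 k); nra.
rewrite mulrDr; apply: lerD.
  case: y => [|y]; first by rewrite mulr0.
  have [yk|yk] := leqP y k.+1; last by rewrite !pweight_supp ?mulr0.
  by apply: step => //; have := ler0n R y; lra.
have [yk|yk] := leqP y.+1 k.+1; last by rewrite !pweight_supp ?mulr0.
by apply: step => //; rewrite -natr1; have := ler0n R y; lra.
Qed.

End Transfer.

(** * The partition function as a power of the transfer operator *)

Section Paths.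
Variable R : realType.
Implicit Types (lam s : R) (k y : nat) (p : seq nat).

(** An arbitrary endpoint y is allowed and the paths are listed by their last
    step, so that sums over them follow the recursion of [pweight]. *)
Fixpoint paths k y : seq (seq nat) :=
  if k is k'.+1 then
    map (rcons^~ y) ((if y is z.+1 then paths k' z else [::]) ++ paths k' y.+1)
  else if y == 0%N then [:: [:: 0%N]] else [::].

Lemma paths_size k y p : p \in paths k y -> size p = k.+1 /\ nth 0%N p k = y.
Proof.
elim: k y p => [|k IHk] y p /=.
  by case: eqP => // -> /[!inE] /eqP ->.
move=> /mapP[q]; rewrite mem_cat => qk ->.
have sq : size q = k.+1.
  by case/orP: qk; [case: y => // z|]; move=> /IHk[].
by rewrite size_rcons nth_rcons sq ltnn eqxx.
Qed.

Lemma mem_paths k y p : p \in paths k y <->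
  [/\ size p = k.+1, nth 0%N p 0 = 0%N, nth 0%N p k = y &
   forall x : nat, (1 <= x <= k)%N ->
     `|(nth 0%N p x)%:Z - (nth 0%N p x.-1)%:Z| = 1].
Proof.
elim: k y p => [|k IHk] y p.
  split=> /=.
    by case: eqP => // -> /[!inE] /eqP ->; split=> // x; case: x.
  by case: p => [|a [|b p]] [] //= _ -> <- _; rewrite inE.
split=> [|[]].
  move=> /mapP[q]; rewrite mem_cat => qk ->.
  have [z [qz zy]] : exists z, q \in paths k z /\ `|y%:Z - z%:Z| = 1.
    by case/orP: qk; [case: y => // z zk; exists z|exists y.+1]; split=> //; lia.
  have [sq q0 qkz step] := (IHk z q).1 qz.
  split; rewrite ?size_rcons ?sq// ?nth_rcons ?sq ?ltnn ?eqxx//.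
  move=> x /andP[x1 xk]; rewrite !nth_rcons !sq.
  have -> : (x.-1 < k.+1)%N by lia.
  have [xk'|xk'] := ltnP x k.+1; first by apply: step; rewrite x1.
  have -> : x = k.+1 by lia.
  by rewrite eqxx /= qkz.
case/lastP: p => // q a; rewrite size_rcons => -[sq] q0 qa step.
have aE : a = y by move: qa; rewrite nth_rcons sq ltnn eqxx.
rewrite {}aE in q0 qa step *; apply: map_f; rewrite mem_cat.
have qz : q \in paths k (nth 0%N q k).
  apply/IHk; split=> //; first by move: q0; rewrite nth_rcons sq.
  move=> x /andP[x1 xk]; have := step x; rewrite !nth_rcons !sq.
  have -> : (x < k.+1)%N by lia.
  have -> : (x.-1 < k.+1)%N by lia.
  by apply; rewrite x1 ltnW.
have := step k.+1; rewrite !nth_rcons sq !ltnn eqxx /= ltnS leqnn => /(_ isT).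
move: qz; set z := nth _ _ _ => qz.
case: y {q0 qa step} => [|y] yz; apply/orP; [right|].
  by have -> : 1%N = z by lia.
have [->|->] : y = z \/ y.+2 = z by lia.
  by left.
by right.
Qed.

Lemma paths_uniq k y : uniq (paths k y).
Proof.
elim: k y => [|k IHk] y /=; first by case: ifP.
rewrite map_inj_uniq; last by move=> p q; exact: rcons_injl.
rewrite cat_uniq IHk; case: y => [|z]; rewrite /= ?andbT ?IHk ?has_pred0//=.
apply/hasPn => p /paths_size[_ pz2]; apply/negP => /= /paths_size[_].
by rewrite pz2 => /eqP; rewrite -[eqbRHS]addn0; lia.
Qed.

(** The correction y / 2 is due to the last edge, of which only one half of the
    final height is counted in [pweight]. *)
Lemma sum_paths lam s k y :
  \sum_(p <- paths k.+1 y)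
    lam ^+ (\sum_(1 <= x < k.+1 | nth 0%N p x == 0%N) 1) *
    expR (s * ((\sum_(1 <= x < k.+2) nth 0%N p x)%:R - y%:R / 2)) =
  2 ^+ k.+1 * pweight lam s k y.
Proof.
elim: k y => [|k IHk] y.
  case: y => [|[|y]] /=; rewrite ?big_nil ?mulr0//.
  rewrite big_seq1 big_geq// big_nat1 /= expr0 mul1r expr1.
  have -> : s * (1 - 1 / 2) = s / 2 by field.
  by field.
pose wt k p y := lam ^+ (\sum_(1 <= x < k | nth 0%N p x == 0%N) 1) *
    expR (s * ((\sum_(1 <= x < k.+1) nth 0%N p x)%:R - y%:R / 2)).
have step z (c : R) : c = z%:R / 2 + y%:R / 2 -> \sum_(p <- paths k.+1 z) wt k.+2 (rcons p y) y =
    2 ^+ k.+2 * (leave lam z * (expR (s * c) / 2) * pweight lam s k z).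
  move=> cE; rewrite [2 ^+ k.+2]exprS.
  have -> : 2 * 2 ^+ k.+1 * (leave lam z * (expR (s * c) / 2) * pweight lam s k z) =
     leave lam z * expR (s * c) * (2 ^+ k.+1 * pweight lam s k z) by field.
  rewrite -IHk mulr_sumr !big_seq; apply: eq_bigr => p /paths_size[sp pz].
  have nthE x : (x < k.+2)%N -> nth 0%N (rcons p y) x = nth 0%N p x.
    by move=> xk; rewrite nth_rcons sp xk.
  have nthy : nth 0%N (rcons p y) k.+2 = y by rewrite nth_rcons sp ltnn eqxx.
  rewrite /wt (big_nat_recr _ _ _ (_ : 1 <= k.+2)%N)//= nthy.
  rewrite big_mkcond (big_nat_recr _ _ _ (_ : 1 <= k.+1)%N)//= nthE// pz -big_mkcond /=.
  rewrite (eq_big_nat _ _ (F2 := fun x => nth 0%N p x)); last first.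
    by move=> x /andP[_ xk]; apply: nthE.
  have -> : (\sum_(1 <= x < k.+1 | nth 0 (rcons p y) x == 0) 1 =
             \sum_(1 <= x < k.+1 | nth 0 p x == 0) 1)%N.
    rewrite big_nat_cond [RHS]big_nat_cond; apply: eq_bigl => x.
    by apply: andb_id2l => /andP[_ xk]; rewrite nthE// ltnW.
  have -> : s * ((\sum_(1 <= x < k.+2) nth 0%N p x + y)%:R - y%:R / 2) =
     s * c + s * ((\sum_(1 <= x < k.+2) nth 0%N p x)%:R - z%:R / 2).
    by rewrite natrD cE; field.
  rewrite expRD exprD /leave; case: (z =P 0%N) => _; rewrite ?expr1 ?expr0; ring.
rewrite [paths _ _]/= big_map big_cat -!/(paths k.+1 _).
have -> : forall r : seq (seq nat), \sum_(p <- r)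
   lam ^+ (\sum_(1 <= x < k.+2 | nth 0%N (rcons p y) x == 0%N) 1) *
    expR (s * ((\sum_(1 <= x < k.+3) nth 0%N (rcons p y) x)%:R - y%:R / 2)) =
   \sum_(p <- r) wt k.+2 (rcons p y) y by [].
rewrite pweightS /transfer mulrDr; congr (_ + _).
  case: y step => [|y] step; first by rewrite big_nil mulr0.
  by apply: step; rewrite -natr1; field.
by apply: step; rewrite -natr1; field.
Qed.

Lemma Z_pweight n lam sigma :
  Z n.+1 lam sigma = pweight lam (sigma / n.+1%:R) (2 * n).+1 0.
Proof.
rewrite /Z; set N := n.+1.
have NE : (2 * N = (2 * n).+2)%N by rewrite /N; lia.
set s := sigma / _.
pose f p := lam ^+ (\sum_(1 <= x < 2 * N | nth 0%N p x == 0%N) 1) *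
   expR (s * (\sum_(1 <= x < (2 * N).+1) nth 0%N p x)%:R).
have -> : \sum_(xi \in Omega N) (lam ^+ contacts xi * expR (s * (area xi)%:R)) =
   \sum_(p \in [set` paths (2 * N) 0]) f p.
  symmetry; apply: (@reindex_fsbig _ _ _ _ _ (fun t : (2 * N).+1.-tuple nat => tval t)).
  split.
  - move=> xi [x0 [xN step]]; apply/mem_paths; split=> //; exact: size_tuple.
  - by move=> a b _ _; exact: val_inj.
  - move=> p /mem_paths[sp p0 pN step].
    by exists (@Tuple (2 * N).+1 _ p (introT eqP sp)).
rewrite -fsbig_seq ?paths_uniq// /f NE.
have -> : pweight lam s (2 * n).+1 0 =
    2 ^- (2 * n).+2 * (2 ^+ (2 * n).+2 * pweight lam s (2 * n).+1 0).
  by rewrite mulKf// expf_eq0 pnatr_eq0.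
rewrite -sum_paths; congr (_ * _).
by apply: eq_bigr => p _; rewrite mul0r subr0.
Qed.

End Paths.

(** * Upper and lower bounds of square norms *)

Section FiniteSequences.
Variable R : realType.
Implicit Types f : nat -> R.

Lemma sum_shift2_le f (M : nat) : (forall y, (M <= y)%N -> f y = 0) ->
  \sum_(y < M) f y.+2 ^+ 2 <= \sum_(y < M) f y ^+ 2.
Proof.
move=> fM; have -> : \sum_(y < M) f y ^+ 2 = \sum_(y < M.+2) f y ^+ 2.
  by rewrite !big_ord_recr /= !fM// expr2 mulr0 !addr0.
rewrite !big_ord_recl /=.
have := sqr_ge0 (f 0%N); have := sqr_ge0 (f 1%N).
have -> : \sum_(i < M) f (bump 0 (bump 0 i)) ^+ 2 = \sum_(y < M) f y.+2 ^+ 2.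
  by apply: eq_bigr.
rewrite /bump /=; lra.
Qed.

(** Nash's inequality on the half-line, for differences at distance 2 (the
    walk changes parity at each step). A maximum of f^2 is a telescoping sum,
    hence at most 2 (D E)^(1/2) with D the Dirichlet energy and E the square
    norm; and E is at most the maximum times the mass. *)
Lemma nash_ineq f (M : nat) : (forall y, 0 <= f y) ->
  (forall y, (M <= y)%N -> f y = 0) ->
  (\sum_(y < M) f y ^+ 2) ^+ 3 <=
  4 * (\sum_(y < M) (f y - f y.+2) ^+ 2) * (\sum_(y < M) f y) ^+ 4.
Proof.
move=> f0 fM; set E := \sum_(y < M) f y ^+ 2; set S := \sum_(y < M) f y.
set D := \sum_(y < M) (f y - f y.+2) ^+ 2.
have E0 : 0 <= E by apply: sumr_ge0 => i _; exact: sqr_ge0.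
have S0 : 0 <= S by exact: sumr_ge0.
have D0 : 0 <= D by apply: sumr_ge0 => i _; exact: sqr_ge0.
pose r := \sum_(y < M) `|f y - f y.+2| * (f y + f y.+2).
have r0 : 0 <= r by apply: sumr_ge0 => i _; rewrite mulr_ge0 ?addr_ge0.
have sup x : f x ^+ 2 <= r.
  have [xM|/fM ->] := ltnP x M; last by rewrite expr2 mul0r.
  have : f x ^+ 2 <= \sum_(x <= y < M) `|f y - f y.+2| * (f y + f y.+2).
    move: {2}(M - x).+1 (ltnSn (M - x)) => n.
    elim: n x {xM} => [|n IHn] x; first by lia.
    have [Mx _|xM xn] := leqP M x; first by rewrite fM// big_geq// expr2 mul0r.
    have tele : f x ^+ 2 <= `|f x - f x.+2| * (f x + f x.+2) + f x.+2 ^+ 2.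
      have : (f x - f x.+2) * (f x + f x.+2) <= `|f x - f x.+2| * (f x + f x.+2).
        by rewrite ler_wpM2r ?addr_ge0// ler_norm.
      by nra.
    rewrite big_ltn//; apply: le_trans tele _; rewrite lerD2l.
    apply: le_trans (IHn x.+2 _) _; first by lia.
    have [Mx|Mx] := leqP M x.+1; first by rewrite !big_geq//; lia.
    by rewrite [leRHS]big_ltn// lerDr mulr_ge0 ?addr_ge0.
  move/le_trans; apply; rewrite /r -(big_mkord xpredT
    (fun y => `|f y - f y.+2| * (f y + f y.+2))).
  rewrite (big_cat_nat (leq0n x) (ltnW xM)) /= lerDr.
  by apply: sumr_ge0 => i _; rewrite mulr_ge0 ?addr_ge0.
have shift := sum_shift2_le fM; rewrite -/E in shift.
have r2 : r ^+ 2 <= D * (4 * E).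
  have := @weighted_cauchy_schwarz R M (fun=> 1) (fun y => `|f y - f y.+2|)
    (fun y => f y + f y.+2) (fun=> ler01).
  under eq_bigr do rewrite mul1r; rewrite -/r => /le_trans; apply.
  under eq_bigr do rewrite mul1r real_normK ?num_real//.
  rewrite -/D ler_wpM2l//; under eq_bigr do rewrite mul1r.
  apply: le_trans (_ : \sum_(y < M) (2 * f y ^+ 2 + 2 * f y.+2 ^+ 2) <= _).
    by apply: ler_sum => i _; have := sqr_ge0 (f i - f i.+2); nra.
  by rewrite big_split /= -!mulr_sumr -/E; lra.
have ES : E ^+ 2 <= r * S ^+ 2.
  have ErS : E <= Num.sqrt r * S.
    rewrite mulr_sumr; apply: ler_sum => i _; rewrite expr2 ler_wpM2r//.
    by rewrite -[leLHS]ger0_norm// -sqrtr_sqr ler_wsqrtr.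
  rewrite -(sqr_sqrtr r0) -exprMn; apply: lerXn2r => //; rewrite nnegrE.
  by rewrite mulr_ge0 ?sqrtr_ge0.
have E4 : E ^+ 4 <= 4 * D * S ^+ 4 * E.
  have -> : E ^+ 4 = (E ^+ 2) ^+ 2 by ring.
  apply: le_trans (_ : (r * S ^+ 2) ^+ 2 <= _).
    by apply: lerXn2r; rewrite ?nnegrE ?mulr_ge0 ?exprn_ge0.
  have -> : 4 * D * S ^+ 4 * E = D * (4 * E) * (S ^+ 4) by ring.
  by rewrite exprMn -exprM; rewrite ler_wpM2r ?exprn_ge0.
have [E_gt0|E_le0] := ltP 0 E; last first.
  have -> : E = 0 by lra.
  by rewrite expr0n /= !mulr_ge0 ?exprn_ge0.
by rewrite -(ler_pM2r E_gt0) -exprSr.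
Qed.

Lemma sum_indicator_le (a b : R) (M : nat) : a <= b ->
  \sum_(y < M) ((a <= y%:R <= b)%R)%:R <= b - a + 1.
Proof.
move=> ab; have key : \sum_(y < M) ((a <= y%:R <= b)%R)%:R <=
    Num.max 0 (Num.min (M%:R - 1) b - a + 1).
  elim: M => [|M IHM]; first by rewrite big_ord0 le_max lexx.
  rewrite big_ord_recr /= -natr1 addrK.
  have [/andP[aM Mb]|_] := boolP (a <= M%:R <= b); rewrite /= ?addr0.
    move: IHM; rewrite /Num.min /Num.max.
    by repeat case: ifPn; rewrite -?leNgt; lra.
  move: IHM; rewrite /Num.min /Num.max.
  by repeat case: ifPn; rewrite -?leNgt; lra.
apply: le_trans key _; rewrite ge_max; apply/andP; split; first by lra.
by rewrite lerD2r lerD2r ge_min lexx orbT.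
Qed.

(** Chebyshev puts half of the mass in a window of length 2 r, and
    Cauchy-Schwarz in the window bounds the square norm from below. *)
Lemma square_norm_ge f (M : nat) (mu A B r : R) : (forall y, 0 <= f y) ->
  0 <= A -> 0 < r -> B <= A / 2 * r ^+ 2 ->
  A <= \sum_(y < M) f y -> \sum_(y < M) f y * (y%:R - mu) ^+ 2 <= B ->
  A ^+ 2 / 4 <= (2 * r + 1) * \sum_(y < M) f y ^+ 2.
Proof.
move=> f0 A0 r0 BA Af fB.
pose w (y : nat) : R := ((mu - r <= y%:R <= mu + r)%R)%:R.
have tail : r ^+ 2 * \sum_(y < M) f y * (1 - w y) <= B.
  apply: le_trans fB; rewrite mulr_sumr; apply: ler_sum => y _.
  rewrite /w; have := f0 y; case: andP => /= H fy; first by rewrite subrr !mulr0 mulr_ge0 ?sqr_ge0.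
  rewrite subr0 mulr1 mulrC ler_wpM2l//.
  have : ~~ ((mu - r <= y%:R) && (y%:R <= mu + r)) by apply/andP.
  by rewrite negb_and -!ltNge => /orP[]; nra.
have Aw : A / 2 <= \sum_(y < M) f y * w y.
  have : r ^+ 2 * \sum_(y < M) f y * (1 - w y) <= r ^+ 2 * (A / 2).
    by apply: le_trans tail _; rewrite mulrC.
  rewrite ler_pM2l ?exprn_gt0//.
  under eq_bigr do rewrite mulrBr mulr1.
  rewrite sumrB; lra.
have := @weighted_cauchy_schwarz R M w (fun=> 1) f.
have w0 i : 0 <= w i by exact: ler0n.
move=> /(_ w0) CS.
have -> : A ^+ 2 / 4 = (A / 2) ^+ 2 by field.
apply: le_trans (_ : (\sum_(y < M) f y * w y) ^+ 2 <= _).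
  by apply: lerXn2r; rewrite ?nnegrE ?divr_ge0 ?sumr_ge0// => i _; rewrite mulr_ge0.
under eq_bigr do rewrite mulrC -[w _]mulr1.
apply: le_trans CS _; apply: ler_pM.
- by apply: sumr_ge0 => i _; rewrite expr1n mulr1.
- by apply: sumr_ge0 => i _; rewrite mulr_ge0 ?sqr_ge0.
- under eq_bigr do rewrite expr1n mulr1.
  apply: le_trans (@sum_indicator_le (mu - r) (mu + r) M _) _; lra.
- apply: ler_sum => y _; rewrite ler_piMl ?sqr_ge0// /w.
  by case: (_ <= _ <= _).
Qed.

End FiniteSequences.

(** * The killed walk in external fields *)

Section KilledWalk.
Variable R : realType.
Implicit Types (h phi : nat -> R) (k y z N M : nat).

(** The missing step from 1 to 0 is the killing. The walk is not normalised:
    without killing its mass is the product of the cosh (h i). *)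
Fixpoint kwalk h k : nat -> R :=
  if k is k'.+1 then
    transfer (fun=> expR (h k') / 2)
      (fun z => if (z <= 1)%N then 0 else expR (- h k') / 2) (kwalk h k')
  else fun y => (y == 0%N)%:R.

Lemma kwalkS h k y : kwalk h k.+1 y =
  if y is z.+1 then expR (h k) / 2 * kwalk h k z + expR (- h k) / 2 * kwalk h k z.+2
  else 0.
Proof. by case: y => [|y] //=; rewrite /transfer /= mul0r addr0. Qed.

Lemma kwalk_ge0 h k y : 0 <= kwalk h k y.
Proof.
elim: k y => [|k IHk] y; first exact: ler0n.
by rewrite kwalkS; case: y => // y; rewrite addr_ge0 ?mulr_ge0 ?expR_ge0 ?invr_ge0.
Qed.

Lemma kwalk_supp h k y : (k < y)%N -> kwalk h k y = 0.
Proof.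
elim: k y => [|k IHk] y; first by case: y.
by rewrite kwalkS; case: y => // y ky; rewrite !IHk ?mulr0 ?addr0//; lia.
Qed.

Lemma kwalk_adjoint h k phi M : (k.+1 < M)%N ->
  \sum_(y < M) phi y * kwalk h k.+1 y =
  \sum_(z < M) kwalk h k z * (expR (h k) / 2 * phi z.+1 +
    if (1 < z)%N then expR (- h k) / 2 * phi z.-1 else 0).
Proof.
move=> kM; rewrite /= transfer_adjoint; last first.
  by move=> y My; apply: kwalk_supp; lia.
apply: eq_bigr => i _; congr (_ * (_ + _)).
by case: (nat_of_ord i) => [|[|z]] //=; rewrite mul0r.
Qed.

(** The fields felt by the steps of an excursion of length 2 N: the area is
    the sum of the increments weighted by their signed distance to the midpoint. *)
Definition tilt (s : R) N (i : nat) : R := s * (N%:R - i%:R - 2^-1).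

(** The change of measure that turns the area into fields. The remaining factor
    is 1 at time N, the middle of the excursion. *)
Lemma pweight_kwalk (s : R) N k y :
  pweight 0 s k y.+1 = kwalk (tilt s N) k.+1 y.+1 *
    expR (- (s * (N%:R - k.+1%:R) * y.+1%:R)).
Proof.
set h := tilt s N; elim: k y => [|k IHk] y.
  rewrite kwalkS /=; case: y => [|y] /=; last by rewrite !mulr0 addr0 mul0r.
  rewrite mulr1 mulr0 addr0 mulrAC -expRD; congr (expR _ / 2).
  by rewrite /h /tilt; field.
rewrite pweightS kwalkS /transfer {1}IHk /down /up !leaveS mul1r.
have step z : expR (h k.+1) / 2 * expR (- (s * (N%:R - k.+2%:R) * z.+2%:R)) =
  expR (s * (z.+1%:R + 2^-1)) / 2 * expR (- (s * (N%:R - k.+1%:R) * z.+1%:R)).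
  rewrite mulrAC -expRD [RHS]mulrAC -expRD; congr (expR _ / 2).
  by rewrite /h /tilt -!natr1; field.
have step' : expR (- h k.+1) / 2 * expR (- (s * (N%:R - k.+2%:R) * y.+1%:R)) =
  expR (s * (y.+2%:R - 2^-1)) / 2 * expR (- (s * (N%:R - k.+1%:R) * y.+2%:R)).
  rewrite mulrAC -expRD [RHS]mulrAC -expRD; congr (expR _ / 2).
  by rewrite /h /tilt -!natr1; field.
rewrite [RHS]mulrDl; congr (_ + _); last first.
  by rewrite mulrCA mulrA -mulrA -step' mulrAC [RHS]mulrAC; ring.
case: y {step'} => [|z].
  by rewrite kwalkS mulr0 !mul0r.
by rewrite leaveS mul1r IHk mulrCA -step; ring.
Qed.

(** Cut at its middle, an excursion is a pair of independent copies of the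
    killed walk which meet at the same height. *)
Lemma excursion_square (s : R) n M : ((2 * n).+3 < M)%N ->
  pweight 0 s (2 * n).+1 0 = \sum_(y < M) kwalk (tilt s n.+1) n.+1 y ^+ 2.
Proof.
move=> nM; have -> : (2 * n = n + n)%N by lia.
rewrite (@pweight_cut _ _ _ _ _ M); last by lia.
apply: eq_bigr => -[[|y] yM] _; rewrite [nat_of_ord _]/=.
  by rewrite /leave eqxx !mul0r kwalkS expr2 mul0r.
rewrite leaveS mul1r (@pweight_kwalk _ n.+1) subrr mulr0 mul0r oppr0 expR0 mulr1.
by rewrite expr2.
Qed.

Lemma kwalk_mass_le h k M : (k < M)%N ->
  \sum_(y < M) kwalk h k y <= \prod_(i < k) cosh (h i).
Proof.
elim: k => [|k IHk] kM.
  rewrite big_ord0; case: M kM => // M _; rewrite big_ord_recl big1//=.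
have := kwalk_adjoint h (fun=> 1) kM; under eq_bigr do rewrite mul1r; move=> ->.
rewrite big_ord_recr /=.
apply: le_trans (_ : (\sum_(y < M) kwalk h k y) * cosh (h k) <= _); last first.
  by rewrite ler_wpM2r ?(ltW (cosh_gt0 _))// IHk// ltnW.
rewrite mulr_suml; apply: ler_sum => y _; rewrite ler_wpM2l ?kwalk_ge0//.
by rewrite /cosh mulrDl !mulr1 lerD2l; case: ifP => // _; rewrite divr_ge0 ?expR_ge0.
Qed.

Lemma kwalk_energy_step h k M : (k.+1 < M)%N ->
  \sum_(y < M) kwalk h k.+1 y ^+ 2 <=
  cosh (h k) ^+ 2 * (\sum_(y < M) kwalk h k y ^+ 2)
  - (\sum_(y < M) (kwalk h k y - kwalk h k y.+2) ^+ 2) / 4.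
Proof.
case: M => // M kM; rewrite big_ord_recl kwalkS expr2 mul0r add0r.
set f := kwalk h k; have f0 y : (M <= y)%N -> f y = 0.
  by move=> My; apply: kwalk_supp; lia.
pose a := expR (h k) / 2; pose b := expR (- h k) / 2.
have ab : a * b = 4^-1 by rewrite /a /b expRN; field; rewrite gt_eqF ?expR_gt0.
have abC : cosh (h k) = a + b by rewrite /a /b -mulrDl.
have a0 : 0 <= a by rewrite divr_ge0 ?expR_ge0.
have b0 : 0 <= b by rewrite divr_ge0 ?expR_ge0.
have -> : \sum_(i < M) kwalk h k.+1 (bump 0 i) ^+ 2 = (a + b) *
    (a * \sum_(y < M) f y ^+ 2 + b * \sum_(y < M) f y.+2 ^+ 2)
    - (\sum_(y < M) (f y - f y.+2) ^+ 2) / 4.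
  rewrite !mulr_sumr -big_split /= mulr_sumr mulr_suml -sumrB.
  apply: eq_bigr => i _; rewrite /bump leq0n add1n -/(kwalk h k.+1 i.+1) kwalkS.
  by rewrite -/f -/a -/b -ab; ring.
have shift := sum_shift2_le f0.
rewrite [X in _ <= _ * X - _]big_ord_recr [X in _ <= _ - X / _]big_ord_recr /=.
rewrite -/f (f0 M)// (f0 M.+2); last by lia.
rewrite subr0 [0 ^+ 2]expr2 mulr0 !addr0 abC lerB//.
rewrite [leRHS](_ : _ = (a + b) * ((a + b) * \sum_(y < M) f y ^+ 2)); last by ring.
by rewrite ler_wpM2l ?addr_ge0// mulrDl lerD2l ler_wpM2l.
Qed.

(** One step dissipates a fraction of the Dirichlet energy, and Nash's
    inequality bounds this below by the cube of the square norm, which therefore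
    decays like k^(-1/2), uniformly over the fields bounded by b. *)
Lemma kwalk_energy_le h (b : R) k M : (k < M)%N -> (forall i, (i < k)%N -> `|h i| <= b) ->
  (\sum_(y < M) kwalk h k y ^+ 2) ^+ 2 * (1 + k%:R / (16 * cosh b ^+ 2))
    <= (\prod_(i < k) cosh (h i)) ^+ 4.
Proof.
elim: k => [|k IHk] kM hb.
  rewrite big_ord0 mul0r addr0 mulr1 expr1n; case: M kM => // M _.
  by rewrite big_ord_recl big1 ?addr0 /= ?expr1n// => i _; rewrite expr2 mul0r.
set e := (16 * _)^-1; rewrite -/e in IHk.
have {}IHk := IHk (ltnW kM) (fun i ik => hb i (ltnW ik)).
have := kwalk_energy_step h kM.
have := @nash_ineq _ (kwalk h k) M (kwalk_ge0 h k) (fun y My => kwalk_supp h (leq_trans (ltnW kM) My)).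
have := kwalk_mass_le h (ltnW kM).
have S0 : 0 <= \sum_(y < M) kwalk h k y by apply: sumr_ge0 => *; exact: kwalk_ge0.
have E'0 : 0 <= \sum_(y < M) kwalk h k.+1 y ^+ 2 by apply: sumr_ge0 => *; exact: sqr_ge0.
have E0 : 0 <= \sum_(y < M) kwalk h k y ^+ 2 by apply: sumr_ge0 => *; exact: sqr_ge0.
have D0 : 0 <= \sum_(y < M) (kwalk h k y - kwalk h k y.+2) ^+ 2.
  by apply: sumr_ge0 => *; exact: sqr_ge0.
rewrite big_ord_recr /=; have Cb : cosh (h k) <= cosh b by apply: ler_cosh; apply: hb.
have C1 := cosh_ge1 (h k).
have P0 : 0 < \prod_(i < k) cosh (h i) by apply: prodr_gt0 => *; exact: cosh_gt0.
move: S0 E'0 E0 D0 P0 IHk C1 Cb.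
move: (\sum_(y < M) kwalk h k y) => S.
move: (\sum_(y < M) kwalk h k.+1 y ^+ 2) => E'.
move: (\sum_(y < M) kwalk h k y ^+ 2) => E.
move: (\sum_(y < M) _) => D.
move: (\prod_(_ < _) _) => P; set C := cosh (h k).
move=> S0 E'0 E0 D0 P0 IHk C1 Cb SP nash step.
have e0 : 0 <= e by rewrite invr_ge0 mulr_ge0 ?exprn_ge0 ?(ltW (cosh_gt0 _)).
have eC : e * (16 * C ^+ 2) <= 1.
  have B0 : 0 < 16 * cosh b ^+ 2 by have := cosh_gt0 b; nra.
  rewrite /e mulrC ler_pdivrMr// mul1r ler_pM2l//.
  by apply: lerXn2r => //; rewrite nnegrE; lra.
(* P is the mass without killing, x the square norm of the normalised law *)
pose x := E / P ^+ 2; have EE : E = x * P ^+ 2.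
  by rewrite /x divfK// expf_eq0 /= gt_eqF.
have P20 : 0 < P ^+ 2 by rewrite exprn_gt0.
have x0 : 0 <= x by rewrite divr_ge0// ltW.
have IHx : x ^+ 2 * (1 + k%:R * e) <= 1.
  rewrite -(ler_pM2r (exprn_gt0 4 P0)) mul1r; apply: le_trans IHk.
  by rewrite EE le_eqVlt; apply/orP; left; apply/eqP; ring.
have SP4 : S ^+ 4 <= P ^+ 4 by apply: lerXn2r => //; rewrite nnegrE// ltW.
have DE : x ^+ 3 * P ^+ 2 <= 4 * D.
  have : E ^+ 3 <= 4 * D * P ^+ 4.
    by apply: le_trans nash _; rewrite ler_wpM2l// mulr_ge0.
  rewrite EE (_ : (x * P ^+ 2) ^+ 3 = x ^+ 3 * P ^+ 2 * P ^+ 4); last by ring.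
  by rewrite ler_pM2r// exprn_gt0.
have ex2 : e * x ^+ 2 <= 1.
  have : x ^+ 2 <= 1.
    apply: le_trans IHx; rewrite ler_peMr ?sqr_ge0//.
    by rewrite lerDl mulr_ge0 ?ler0n.
  have : e <= 1.
    have : 1 <= 16 * C ^+ 2 by nra.
    have : e <= e * (16 * C ^+ 2) by rewrite ler_peMr//; nra.
    lra.
  have := sqr_ge0 x; nra.
have step' : E' <= (C * P) ^+ 2 * (x * (1 - e * x ^+ 2)).
  apply: le_trans step _.
  have : e * (16 * C ^+ 2) * (x ^+ 3 * P ^+ 2) <= 4 * D.
    apply: le_trans DE; rewrite ler_piMl// mulr_ge0 ?exprn_ge0// ltW//.
  rewrite EE.
  have -> : (C * P) ^+ 2 * (x * (1 - e * x ^+ 2)) =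
    C ^+ 2 * (x * P ^+ 2) - e * (16 * C ^+ 2) * (x ^+ 3 * P ^+ 2) / 16 by field.
  by lra.
have CP0 : 0 <= C * P by rewrite mulr_ge0 ?ltW//; lra.
apply: le_trans (_ : ((C * P) ^+ 2 * (x * (1 - e * x ^+ 2))) ^+ 2 * (1 + k.+1%:R * e) <= _).
  rewrite ler_wpM2r//; first by rewrite addr_ge0// mulr_ge0.
  by apply: lerXn2r; rewrite ?nnegrE// mulr_ge0 ?sqr_ge0// mulr_ge0//; lra.
have -> : ((C * P) ^+ 2 * (x * (1 - e * x ^+ 2))) ^+ 2 * (1 + k.+1%:R * e) =
  (P * C) ^+ 4 * ((1 - e * x ^+ 2) ^+ 2 * (x ^+ 2 * (1 + k%:R * e) + e * x ^+ 2)).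
  by rewrite -natr1; ring.
rewrite ler_piMr ?exprn_ge0//; first by rewrite mulrC.
set t := e * x ^+ 2; have t0 : 0 <= t by rewrite mulr_ge0 ?sqr_ge0.
have t1 : t <= 1 by [].
apply: le_trans (_ : (1 - t) ^+ 2 * (1 + t) <= 1); last by nra.
by rewrite ler_wpM2l ?sqr_ge0// lerD2r.
Qed.

Lemma kwalk_energy_le_prod h k M : (k < M)%N ->
  \sum_(y < M) kwalk h k y ^+ 2 <= (\prod_(i < k) cosh (h i)) ^+ 2.
Proof.
move=> kM; have S := kwalk_mass_le h kM.
apply: le_trans (_ : (\sum_(y < M) kwalk h k y) ^+ 2 <= _); last first.
  apply: lerXn2r; rewrite ?nnegrE//; first by apply: sumr_ge0 => *; exact: kwalk_ge0.
  by apply: prodr_ge0 => *; rewrite ltW ?cosh_gt0.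
rewrite [leRHS]expr2 mulr_suml; apply: ler_sum => y _; rewrite expr2.
rewrite ler_wpM2l ?kwalk_ge0// (bigD1 y)//= lerDl.
by apply: sumr_ge0 => *; exact: kwalk_ge0.
Qed.

End KilledWalk.

(** * The lower bound for excursions *)

Section LowerBound.
Variable R : realType.
Implicit Types (h : nat -> R) (k y z M : nat).

(** The centre mu follows the mean tanh (h i) of each step, so that each step
    adds at most its variance; killing only removes mass. *)
Lemma kwalk_variance_le h k M : (k < M)%N ->
  exists mu : R, \sum_(y < M) kwalk h k y * (y%:R - mu) ^+ 2
    <= k%:R * \prod_(i < k) cosh (h i).
Proof.
elim: k => [|k IHk] kM.
  exists 0; rewrite mul0r; case: M kM => // M _; rewrite big_ord_recl big1 => [|i _].
    by rewrite /= subrr expr2 mul0r mulr0 addr0.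
  by rewrite /= mul0r.
have [mu IH] := IHk (ltnW kM).
pose C := cosh (h k); have C0 : 0 < C by exact: cosh_gt0.
pose t := (expR (h k) - expR (- h k)) / (2 * C).
exists (mu + t).
under eq_bigr do rewrite mulrC.
rewrite (kwalk_adjoint h (fun y => (y%:R - (mu + t)) ^+ 2) kM) big_ord_recr /= -/C.
have mass := kwalk_mass_le h (ltnW kM).
apply: le_trans (_ : C * (\sum_(y < M) kwalk h k y * (y%:R - mu) ^+ 2 +
   \sum_(y < M) kwalk h k y) <= _); last first.
  by rewrite mulrA mulrC ler_pM2r// -natr1 mulrDl mul1r lerD.
rewrite -big_split /= mulr_sumr; apply: ler_sum => -[y yM] _ /=.
set w := kwalk h k y; have w0 : 0 <= w by exact: kwalk_ge0.
rewrite [leRHS](_ : _ = w * (C * ((y%:R - mu) ^+ 2 + 1))); last by ring.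
rewrite ler_wpM2l//.
have tC : t * C = (expR (h k) - expR (- h k)) / 2.
  by rewrite /t; field; rewrite gt_eqF.
have CE : C = (expR (h k) + expR (- h k)) / 2 by [].
set u := y%:R - mu.
have full : expR (h k) / 2 * (y%:R + 1 - (mu + t)) ^+ 2 +
    expR (- h k) / 2 * (y%:R - 1 - (mu + t)) ^+ 2 = C * (u ^+ 2 + 1) - C * t ^+ 2.
  transitivity (C * (u - t) ^+ 2 + 2 * ((expR (h k) - expR (- h k)) / 2) * (u - t) + C).
    by rewrite CE /u; field.
  by rewrite -tC; ring.
have t2 : 0 <= C * t ^+ 2 by rewrite mulr_ge0 ?sqr_ge0// ltW.
have neg : 0 <= expR (- h k) / 2 * (y%:R - 1 - (mu + t)) ^+ 2.
  by rewrite mulr_ge0 ?sqr_ge0// divr_ge0 ?expR_ge0.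
rewrite -(natr1 y); case: ifPn => [y1|_]; last by lra.
have -> : y.-1%:R = y%:R - 1 :> R by rewrite -subn1 natrB// ltnW.
lra.
Qed.

(** In the fields s (N - k - 1/2), which push upwards until time N, the killed
    walk survives with a probability bounded below. The reason is a
    submartingale 1 - exp (- th y) cosh(th)^min(k, N - k): one step multiplies
    E exp (- th y) by cosh(h - th) / cosh h, which is at most 1 / cosh th while
    h >= th and never exceeds cosh th. With th = s N / 2 the field
    is at least th half of the time, and the factors gained in this first half
    pay for the second one. *)
Lemma kwalk_survival (s : R) N M : (0 < N < M)%N -> 0 <= s ->
  (1 - expR (- (s * N%:R))) / 4 * \prod_(i < N) cosh (tilt s N i)
    <= \sum_(y < M) kwalk (tilt s N) N y.
Proof.
move=> /andP[N0 NM] s0; set h := tilt s N; pose th := s * N%:R / 2.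
have th0 : 0 <= th by rewrite divr_ge0 ?mulr_ge0.
have ch0 := cosh_gt0 th; have ch1 := cosh_ge1 th.
pose phi k (y : nat) : R := 1 - expR (- (th * y%:R)) * cosh th ^+ minn k (N - k).
have phi0 k : phi k 0%N <= 0.
  rewrite /phi mulr0 oppr0 expR0 mul1r subr_le0 -[leLHS](expr1n _ (minn k (N - k))).
  by apply: lerXn2r; rewrite ?nnegrE ?ler01// ltW.
have field_step k z : (k < N)%N -> cosh (h k) * phi k z.+1 <=
   expR (h k) / 2 * phi k.+1 z.+2 + expR (- h k) / 2 * phi k.+1 z.
  move=> kN.
  have hk0 : 0 <= h k.
    rewrite mulr_ge0//; have : k.+1%:R <= N%:R :> R by rewrite ler_nat.
    by rewrite -natr1; lra.
  have key : cosh (h k - th) * cosh th ^+ minn k.+1 (N - k.+1) <=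
             cosh (h k) * cosh th ^+ minn k (N - k).
    have [kN2|kN2] := leqP (2 * k).+1 N.
      have hth : 0 <= th <= h k.
        rewrite th0 /h /th -mulrA ler_wpM2l//.
        have : (2 * k).+1%:R <= N%:R :> R by rewrite ler_nat.
        by rewrite -natr1 natrM; lra.
      have -> : minn k (N - k) = k by lia.
      apply: le_trans (_ : cosh (h k - th) * cosh th ^+ k.+1 <= _).
        rewrite ler_wpM2l ?(ltW (cosh_gt0 _))// ler_weXn2l//; lia.
      rewrite exprS mulrA ler_wpM2r ?exprn_ge0 ?(ltW ch0)//.
      exact: cosh_sub_ge.
    have -> : minn k.+1 (N - k.+1) = (N - k.+1)%N by lia.
    have -> : minn k (N - k) = (N - k.+1).+1 by lia.
    rewrite exprS mulrA ler_wpM2r ?exprn_ge0 ?(ltW ch0)//.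
    exact: cosh_sub_le.
  have -> : expR (h k) / 2 * phi k.+1 z.+2 + expR (- h k) / 2 * phi k.+1 z =
    cosh (h k) - expR (- (th * z.+1%:R)) *
      (cosh (h k - th) * cosh th ^+ minn k.+1 (N - k.+1)).
    have -> : cosh (h k - th) = (expR (h k) * expR (- th) + expR (- h k) * expR th) / 2.
      by rewrite /cosh -!expRD opprB [th - _]addrC.
    rewrite /phi /cosh (_ : - (th * z.+2%:R) = - (th * z.+1%:R) - th); last first.
      by rewrite -(natr1 z.+1); ring.
    rewrite (_ : - (th * z%:R) = - (th * z.+1%:R) + th); last by rewrite -natr1; ring.
    by rewrite !expRD; ring.
  rewrite /phi mulrBr mulr1 lerB// [leRHS]mulrCA.
  by rewrite ler_wpM2l ?expR_ge0.
have J k : (0 < k <= N)%N ->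
    (1 - expR (- (s * N%:R))) / 4 * \prod_(i < k) cosh (h i) <=
    \sum_(y < M) kwalk h k y * phi k y.
  elim: k => [|k IHk]// /= kN.
  have -> : \sum_(y < M) kwalk h k.+1 y * phi k.+1 y =
      \sum_(y < M) phi k.+1 y * kwalk h k.+1 y.
    by apply: eq_bigr => y _; rewrite mulrC.
  rewrite (kwalk_adjoint h (phi k.+1)); last by lia.
  case: k IHk kN => [_|k IHk] kN.
    case: M NM => // M NM; rewrite big_ord1 big_ord_recl big1 ?addr0 => [|i _]; last first.
      by rewrite /= mul0r.
    rewrite /= mul1r ?addr0.
    have : (1 - expR (- (s * N%:R))) / 2 <= phi 1%N 1%N.
      have ->: s * N%:R = th + th by rewrite /th; field.
      have : expR (- th) * cosh th ^+ minn 1 (N - 1) <= expR (- th) * cosh th.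
        rewrite ler_wpM2l ?expR_ge0// -[leRHS]expr1 ler_weXn2l//; lia.
      rewrite /phi mulr1 /cosh opprD expRD.
      have := expRxMexpNx_1 th; nra.
    have : 0 <= (1 - expR (- (s * N%:R))) / 2.
      by rewrite divr_ge0// subr_ge0 -expR0 ler_expR oppr_le0 mulr_ge0.
    have : cosh (h 0%N) <= expR (h 0%N).
      rewrite /cosh; have : expR (- h 0%N) <= expR (h 0%N); last by lra.
      rewrite ler_expR; suff : 0 <= h 0%N by lra.
      rewrite mulr_ge0// subr0; have : 1 <= N%:R :> R by rewrite ler1n.
      by lra.
    have := expR_gt0 (h 0%N); nra.
  have {}IHk := IHk (ltnW kN).
  rewrite big_ord_recr /= mulrA -/(kwalk h k.+1).
  apply: le_trans (_ : (\sum_(y < M) kwalk h k.+1 y * phi k.+1 y) * cosh (h k.+1) <= _).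
    by apply: ler_wpM2r IHk; exact/ltW/cosh_gt0.
  rewrite mulr_suml; apply: ler_sum => -[[|y] yM] _.
    by rewrite [nat_of_ord _]/= kwalkS !mul0r.
  rewrite [nat_of_ord _]/= -mulrA ler_wpM2l ?kwalk_ge0// mulrC.
  apply: le_trans (field_step k.+1 y kN) _; rewrite lerD2l.
  by case: y yM => [|y] _ //=; rewrite mulr_ge0_le0// divr_ge0 ?expR_ge0.
have := J N; rewrite N0 leqnn => /(_ isT) /le_trans; apply.
apply: ler_sum => y _; rewrite ler_piMr ?kwalk_ge0// /phi gerBl.
by rewrite mulr_ge0 ?expR_ge0 ?exprn_ge0// ltW.
Qed.

(** The two halves of an excursion are independent copies of the killed walk,
    so its weight is a square norm, bounded below because a positive fraction
    of the mass survives and lies in a window of width of order N^(1/2). *)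
Lemma excursion_ge (s c : R) n : 0 < s ->
  c = (1 - expR (- (s * n.+1%:R))) / 4 ->
  c ^+ 2 / 4 * (\prod_(i < n.+1) cosh (tilt s n.+1 i)) ^+ 2 <=
  (2 * Num.sqrt (2 * n.+1%:R / c) + 1) * pweight 0 s (2 * n).+1 0.
Proof.
move=> s0 cE; rewrite (@excursion_square _ _ _ (2 * n).+4)//.
have c0 : 0 < c.
  by rewrite cE divr_gt0// subr_gt0 -expR0 ltr_expR oppr_lt0 mulr_gt0.
have nM : (n.+1 < (2 * n).+4)%N by lia.
have [mu var] := kwalk_variance_le (tilt s n.+1) nM.
set P := \prod_(_ < _) _ in var *.
have P0 : 0 < P by apply: prodr_gt0 => *; exact: cosh_gt0.
have -> : c ^+ 2 / 4 * P ^+ 2 = (c * P) ^+ 2 / 4 by field.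
have q0 : 0 < 2 * n.+1%:R / c by rewrite divr_gt0// mulr_gt0.
apply: (@square_norm_ge _ _ _ mu (c * P) (n.+1%:R * P)) => //.
- by move=> y; exact: kwalk_ge0.
- by rewrite mulr_ge0// ltW.
- by rewrite sqrtr_gt0.
- rewrite sqr_sqrtr ?(ltW q0)// le_eqVlt; apply/orP; left; apply/eqP.
  by field; rewrite gt_eqF.
- by rewrite cE; apply: kwalk_survival; rewrite ?ltW//; lia.
Qed.

End LowerBound.

(** * The rate function G and the midpoint rule *)

Section RateFunction.
Variable R : realType.
Implicit Types (sigma x a b : R) (n : nat).

Let f sigma x := ln (cosh (sigma * (1 - 2 * x))).
(* The base point -1 makes all of [0, 1] interior, where Phi is a primitive. *)
Let Phi sigma x := \int[lebesgue_measure]_(t in `[(-1 : R), x]) f sigma t.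

Let f_lip sigma x y : 0 <= sigma -> `|f sigma x - f sigma y| <= 2 * sigma * `|x - y|.
Proof.
move=> s0.
have H u v : f sigma u - f sigma v <= 2 * sigma * `|u - v|.
  apply: le_trans (ln_cosh_lipschitz _ _) _.
  have -> : sigma * (1 - 2 * u) - sigma * (1 - 2 * v) = - (2 * sigma) * (u - v) by ring.
  by rewrite normrM normrN (ger0_norm (mulr_ge0 _ s0)).
by rewrite ler_norml; have := H x y; have := H y x; rewrite distrC; lra.
Qed.

Let f_continuous sigma : continuous (f sigma).
Proof.
move=> x; rewrite /f; apply: continuous_comp; last first.
  by apply: continuous_ln; exact: cosh_gt0.
have lin (c : R) : {for x, continuous (fun t : R => c * (sigma * (1 - 2 * t)))}.
  apply: cvgM; first exact: cvg_cst.
  apply: cvgM; first exact: cvg_cst.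
  apply: cvgB; first exact: cvg_cst.
  by apply: cvgM; [exact: cvg_cst|exact: cvg_id].
rewrite /cosh; apply: cvgM; last exact: cvg_cst.
have := lin 1; rewrite (_ : (fun t => 1 * _) = (fun t => sigma * (1 - 2 * t))); last first.
  by apply/funext => t; rewrite mul1r.
have := lin (-1); rewrite (_ : (fun t => -1 * _) = (fun t => - (sigma * (1 - 2 * t)))); last first.
  by apply/funext => t; rewrite mulN1r.
move=> l1 l2; apply: cvgD.
  by apply: continuous_comp; [exact: l2|exact: continuous_expR].
by apply: continuous_comp; [exact: l1|exact: continuous_expR].
Qed.

Let f_integrable sigma a b :
  lebesgue_measure.-integrable `[a, b] (EFin \o f sigma).
Proof.
apply: continuous_compact_integrable; first exact: segment_compact.
by apply: continuous_subspaceT => x; exact: f_continuous.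
Qed.

Let Phi_derive sigma x : -1 < x -> is_derive x 1 (Phi sigma) (f sigma x).
Proof.
move=> x1; have [] := @continuous_FTC1_closed R (f sigma) (-1) x (x + 1) _
  (f_integrable _ _ _) x1 (@f_continuous sigma x); first by lra.
rewrite derive1E => dP eP; exact: DeriveDef dP eP.
Qed.

Let Phi_mvt sigma a b : 0 <= a < b ->
  exists2 c, a < c < b & Phi sigma b - Phi sigma a = f sigma c * (b - a).
Proof.
move=> /andP[a0 ab].
have [c cab E] : exists2 c, c \in `]a, b[ & Phi sigma b - Phi sigma a = f sigma c * (b - a).
  apply: MVT => //.
    by move=> x; rewrite in_itv /= => /andP[ax _]; apply: Phi_derive; lra.
  apply: derivable_within_continuous => x; rewrite in_itv /= => /andP[ax _].
  by have [] : is_derive x 1 (Phi sigma) (f sigma x) by apply: Phi_derive; lra.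
by exists c => //; move: cab; rewrite in_itv.
Qed.

Let G_Phi sigma : G sigma = Phi sigma 1 - Phi sigma 0.
Proof.
rewrite /G /Phi Rintegral_itvB ?bnd_simp//.
rewrite Rintegral_itv_obnd_cbnd//.
apply: (integrableS _ _ _ (f_integrable sigma 0 1)) => //=.
by apply: subset_itvr; rewrite bnd_simp.
Qed.

Lemma G0 : G 0 = 0 :> R.
Proof.
rewrite G_Phi; have [|c _ ->] := @Phi_mvt 0 0 1; first by rewrite lexx ltr01.
by rewrite /f mul0r cosh0 ln1 mul0r.
Qed.

Lemma ln_cosh_gt0 x : 0 < x -> 0 < ln (cosh x).
Proof.
move=> x0; apply: ln_gt0; rewrite /cosh expRN; have e := expR_gt0 x.
have e1 : 1 < expR x by rewrite -expR0 ltr_expR.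
have : 0 < (expR x - 1) ^+ 2 / expR x by rewrite divr_gt0// exprn_gt0// subr_gt0.
have -> : (expR x - 1) ^+ 2 / expR x = expR x + (expR x)^-1 - 2.
  by field; rewrite gt_eqF.
lra.
Qed.

Lemma G_gt0 sigma : 0 < sigma -> 0 < G sigma.
Proof.
move=> s0; rewrite G_Phi.
have [|c /andP[_ c4] E] := @Phi_mvt sigma 0 4^-1; first by apply/andP; split; lra.
have [|d _ E'] := @Phi_mvt sigma 4^-1 1; first by apply/andP; split; lra.
have fd : 0 <= f sigma d by exact: ln_cosh_ge0.
have fc : 0 < f sigma c by apply: ln_cosh_gt0; rewrite mulr_gt0//; lra.
lra.
Qed.

(** The error of the midpoint rule with n nodes is of order 1 / n for a
    Lipschitz function, so n times the integral is known up to a constant. *)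
Let midpoint sigma n : 0 <= sigma -> (0 < n)%N ->
  `|n%:R * G sigma - \sum_(i < n) f sigma ((i%:R + 2^-1) / n%:R)| <= sigma.
Proof.
move=> s0 n0; have nR : 0 < n%:R :> R by rewrite ltr0n.
have -> : n%:R * G sigma =
    \sum_(i < n) n%:R * (Phi sigma (i.+1%:R / n%:R) - Phi sigma (i%:R / n%:R)).
  rewrite -mulr_sumr G_Phi; congr (_ * _).
  rewrite -(big_mkord xpredT (fun i => Phi sigma (i.+1%:R / n%:R) - Phi sigma (i%:R / n%:R))).
  by rewrite telescope_sumr// mul0r mulfV// gt_eqF.
rewrite -sumrB; apply: le_trans (ler_norm_sum _ _ _) _.
apply: le_trans (_ : \sum_(i < n) sigma / n%:R <= _); last first.
  by rewrite sumr_const card_ord -(mulr_natr (sigma / _)) divfK// gt_eqF.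
apply: ler_sum => i _.
have iN : 0 <= i%:R / n%:R :> R by rewrite divr_ge0.
have dE : i.+1%:R / n%:R = i%:R / n%:R + n%:R^-1 :> R.
  by rewrite -natr1 mulrDl mul1r.
have nV : 0 < n%:R^-1 :> R by rewrite invr_gt0.
have [|c /andP[ic ci] ->] := @Phi_mvt sigma (i%:R / n%:R) (i.+1%:R / n%:R).
  by rewrite iN dE; lra.
rewrite dE [_ + _ - _]addrC addKr mulrCA mulfV ?gt_eqF// mulr1.
apply: le_trans (f_lip _ _ s0) _.
have : `|c - (i%:R + 2^-1) / n%:R| <= 2^-1 * n%:R^-1.
  by rewrite mulrDl ler_norml; rewrite dE in ci; lra.
move=> H; apply: le_trans (ler_wpM2l _ H) _; first by rewrite mulr_ge0.
by rewrite le_eqVlt; apply/orP; left; apply/eqP; field; rewrite gt_eqF.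
Qed.

(** The sum is half of the one over the 2 n midpoints of [0, 1], where the
    arguments sigma (1 - 2 x) come in opposite pairs. *)
Lemma G_midpoint sigma n : 0 <= sigma -> (0 < n)%N ->
  `|2 * n%:R * G sigma - 2 * \sum_(i < n) ln (cosh (sigma * ((i%:R + 2^-1) / n%:R)))|
    <= sigma.
Proof.
move=> s0 n0; have nR : n%:R != 0 :> R by rewrite pnatr_eq0 -lt0n.
have := @midpoint sigma (n + n) s0 ltac:(lia).
have -> : (n + n)%:R * G sigma = 2 * n%:R * G sigma by rewrite natrD; ring.
rewrite big_split_ord /=.
rewrite (reindex_inj rev_ord_inj) /=.
rewrite (_ : \sum_(i < n) _ + _ =
  2 * \sum_(i < n) ln (cosh (sigma * ((i%:R + 2^-1) / n%:R))))//.
rewrite mulrDl mul1r; congr (_ + _); apply: eq_bigr => i _; rewrite /f.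
  congr (ln (cosh (sigma * _))).
  have -> : (n - i.+1)%:R = n%:R - i%:R - 1 :> R.
    by rewrite natrB// -(natr1 i) opprD addrA.
  by rewrite natrD; field; rewrite nR -natrD pnatr_eq0; lia.
rewrite -coshN; congr (ln (cosh _)).
by rewrite !natrD; field; rewrite nR -natrD pnatr_eq0; lia.
Qed.

End RateFunction.

(** * Renewal equations with long jumps *)

Section Renewal.
Variable R : realType.

Lemma sum_geometric_rev_le (c : R) (k n : nat) : 0 < c -> (k <= n)%N ->
  \sum_(i < k) expR (- (c * (n%:R - i.+1%:R))) <=
    expR (- (c * (n%:R - k%:R))) * (expR c / c).
Proof.
move=> c0 kn; rewrite (reindex_inj rev_ord_inj) /=.
have -> : \sum_(j < k) expR (- (c * (n%:R - (k - j.+1).+1%:R))) =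
   expR (- (c * (n%:R - k%:R))) * (expR c * \sum_(j < k) expR (- (c * j.+1%:R))).
  rewrite !mulr_sumr; apply: eq_bigr => i _; rewrite -!expRD; congr expR.
  by rewrite subnSK// natrB ?(ltnW (ltn_ord i))// -natr1; ring.
by rewrite ler_wpM2l ?expR_ge0// ler_wpM2l ?expR_ge0// sum_geometric_le.
Qed.

(** A renewal equation up to time 2 N whose kernel decays exponentially away
    from both 0 and 2 N, with mass at most 1 + O(1/N) near 0. At most one jump
    is longer than N; the jumps shorter than N multiply the solution by a
    bounded factor, so that the solution is bounded by the sum of the kernel. *)
Lemma renewal_bound (N : nat) (lam c D A Y : R) (u q : nat -> R) :
  (0 < N)%N -> 0 <= lam -> 0 < c -> 0 <= D -> 0 <= A -> 0 <= Y ->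
  (forall k, 0 <= u k) -> (forall k, 0 <= q k) ->
  (forall k, (k < 2 * N)%N ->
     u k <= q k + lam * \sum_(m < k) u m * q (k - m.+1)%N) ->
  (forall k, (k < N)%N -> q k <= A * expR (- (c * k.+1%:R))) ->
  (forall k, (N <= k < 2 * N)%N ->
     q k <= Y * expR (- (c * ((2 * N)%:R - k.+1%:R)))) ->
  lam * \sum_(i < N) q i <= 1 + D / N%:R ->
  forall k, (k < 2 * N)%N -> u k <= expR (2 * D) *
    (A / c + Y * (1 + lam * (expR (2 * D) * (A / c)) * (expR c / c)) * (expR c / c)).
Proof.
move=> N0 l0 c0 D0 A0 Y0 u0 q0 Hu Hs Hl Hm.
have small k : (k < N)%N -> (k < 2 * N)%N by clear; lia.
have NR : 0 < N%:R :> R by rewrite ltr0n.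
have DN0 : 0 <= D / N%:R by rewrite divr_ge0// ltW.
have powD k : (k <= 2 * N)%N -> (1 + D / N%:R) ^+ k <= expR (2 * D).
  move=> kN; apply: le_trans (_ : (1 + D / N%:R) ^+ (2 * N) <= _).
    by apply: ler_weXn2l => //; lra.
  rewrite mulnC exprM expRM_natl.
  apply: lerXn2r; rewrite ?nnegrE ?expR_ge0 ?exprn_ge0//; first by lra.
  exact: expR_ge1D_pow.
have cV : 0 < c^-1 by rewrite invr_gt0.
have short M k (v : nat -> R) : 0 <= M -> (forall m, (m < k)%N -> 0 <= v m <= M) ->
    lam * \sum_(m < k | (k - m.+1 < N)%N) v m * q (k - m.+1)%N <= (1 + D / N%:R) * M.
  move=> M0 vM; apply: le_trans (_ : (lam * \sum_(i < N) q i) * M <= _).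
    rewrite -mulrA ler_wpM2l// mulr_suml.
    rewrite (reindex_inj rev_ord_inj) /=.
    apply: le_trans (_ : \sum_(i < k | (i < N)%N) q i * M <= _).
      apply: le_trans (_ : \sum_(i < k | (i < N)%N) v (k - i.+1)%N * q i <= _).
        rewrite le_eqVlt; apply/orP; left; apply/eqP; apply: eq_big => i.
          by congr (_ < N)%N; case: i => /= i; clear; lia.
        by move=> _; congr (_ * q _); case: i => /= i; clear; lia.
      apply: ler_sum => i _; rewrite mulrC ler_wpM2l//.
      by have /andP[] := vM (k - i.+1)%N (rev_ord_proof i).
    rewrite -(big_mkord (fun i => i < N)%N (fun i => q i * M)).
    rewrite -(big_mkord xpredT (fun i => q i * M)).
    have [kN|Nk] := leqP k N.
      rewrite big_mkcond (big_cat_nat (leq0n k) kN) /=.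
      apply: le_trans (_ : \sum_(0 <= i < k) q i * M <= _); last first.
        by rewrite lerDl; apply: sumr_ge0 => i _; rewrite mulr_ge0.
      by apply: ler_sum => i _; case: ifP => // _; rewrite mulr_ge0.
    rewrite big_mkcond (big_cat_nat (leq0n N) (ltnW Nk)) /=.
    rewrite [X in _ + X <= _]big_nat_cond [X in _ + X <= _]big1 ?addr0.
      by apply: ler_sum => i _; case: ifP => // _; rewrite mulr_ge0.
    by move=> i /andP[/andP[Ni _] _]; rewrite ltnNge Ni.
  by rewrite ler_wpM2r.
(* X bounds u before time N, where only short jumps are possible *)
pose X := expR (2 * D) * (A / c).
have X0 : 0 <= X by rewrite !mulr_ge0 ?expR_ge0// ltW.
have uX k : (k < N)%N -> u k <= X.
  move=> kN.
  have GR := @discrete_gronwall R N (D / N%:R) u q DN0 q0.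
  apply: le_trans (GR _ k kN) _.
    move=> {kN}k M kN M0 uM; apply: le_trans (Hu k (small _ kN)) _.
    have vM m : (m < k)%N -> 0 <= u m <= M by move=> mk; rewrite u0 uM.
    rewrite addrC lerD2r; have := short M k u M0 vM.
    rewrite (eq_bigl xpredT)//= => m.
    by move: kN; clear; lia.
  apply: ler_pM.
  - by rewrite exprn_ge0//; lra.
  - exact: sumr_ge0.
  - exact/powD/small.
  - apply: le_trans (_ : \sum_(m < k.+1) A * expR (- (c * m.+1%:R)) <= _).
      by apply: ler_sum => i _; apply: Hs; exact: leq_trans (ltn_ord i) kN.
    by rewrite -mulr_sumr ler_wpM2l// sum_geometric_le.
(* after time N, the long jumps act as a forcing term, since they start from
   times before N *)
pose W := Y * (1 + lam * X * (expR c / c)).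
have W0 : 0 <= W.
  by rewrite mulr_ge0// addr_ge0// mulr_ge0 ?mulr_ge0// ?expR_ge0// ltW.
pose r k := A * expR (- (c * k.+1%:R)) + W * expR (- (c * ((2 * N)%:R - k.+1%:R))).
have r0 k : 0 <= r k by rewrite addr_ge0// mulr_ge0 ?expR_ge0.
move=> k kN; rewrite -/X -/W.
apply: le_trans (@discrete_gronwall R (2 * N) (D / N%:R) u r DN0 r0 _ k kN) _; last first.
  apply: ler_pM.
  - by rewrite exprn_ge0//; lra.
  - exact: sumr_ge0.
  - exact: powD.
  - rewrite big_split /= -!mulr_sumr; apply: lerD.
      by rewrite ler_wpM2l// sum_geometric_le.
    rewrite ler_wpM2l//; apply: le_trans (sum_geometric_rev_le c0 kN) _.
    rewrite ler_piMl ?divr_ge0 ?expR_ge0 ?(ltW c0)// -[leRHS]expR0 ler_expR oppr_le0.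
    by rewrite mulr_ge0 ?(ltW c0)// subr_ge0 ler_nat.
move=> {kN}k M kN M0 uM; apply: le_trans (Hu k kN) _.
rewrite (bigID (fun m : 'I_k => (k - m.+1 < N)%N)) /= mulrDr addrCA lerD//.
  by apply: short => // m mk; rewrite u0 uM.
set S := \sum_(m < k | _) _.
have SY : S <= X * (Y * (expR (- (c * ((2 * N)%:R - k.+1%:R))) * (expR c / c))).
  apply: le_trans (_ : \sum_(m < k) X * (Y * expR (- (c * ((2 * N)%:R - (k - m.+1).+1%:R)))) <= _).
    rewrite /S big_mkcond; apply: ler_sum => m _; have mk := ltn_ord m.
    case: ifPn => [|_]; last by rewrite mulr_ge0// mulr_ge0 ?expR_ge0.
    rewrite -leqNgt => mN; apply: ler_pM => //; first by apply: uX; move: mk mN kN; clear; lia.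
    by apply: Hl; move: mk mN kN; clear; lia.
  rewrite -!mulr_sumr ler_wpM2l// ler_wpM2l// (reindex_inj rev_ord_inj) /=.
  have -> : \sum_(j < k) expR (- (c * ((2 * N)%:R - (k - (k - j.+1).+1).+1%:R))) =
     \sum_(j < k) expR (- (c * ((2 * N)%:R - j.+1%:R))).
    apply: eq_bigr => i _; have ik := ltn_ord i.
    by have -> : ((k - (k - i.+1).+1).+1 = i.+1)%N by move: ik; clear; lia.
  apply: le_trans (sum_geometric_rev_le c0 (ltnW kN)) _.
  rewrite ler_wpM2r ?divr_ge0 ?expR_ge0 ?(ltW c0)// ler_expR lerN2 ler_wpM2l ?(ltW c0)//.
  by rewrite lerD2l lerN2 ler_nat.
have qk : q k <= A * expR (- (c * k.+1%:R)) + Y * expR (- (c * ((2 * N)%:R - k.+1%:R))).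
  have [kN'|Nk] := ltnP k N.
    by apply: le_trans (Hs k kN') _; rewrite lerDl mulr_ge0 ?expR_ge0.
  have := Hl k; rewrite Nk kN => /(_ isT) /le_trans; apply.
  by rewrite lerDr mulr_ge0 ?expR_ge0.
have := ler_wpM2l l0 SY; rewrite /r /W; nra.
Qed.

End Renewal.

(** * Bounds for the weights of excursions *)

Section ExcursionWeights.
Variable R : realType.
Implicit Types (lam sigma g : R) (k m n N M : nat).

Lemma prod_tilt (s : R) m :
  (\prod_(i < m) cosh (tilt s m i)) ^+ 2 =
  expR (2 * \sum_(i < m) ln (cosh (s * (i%:R + 2^-1)))).
Proof.
have -> : \prod_(i < m) cosh (tilt s m i) =
    expR (\sum_(i < m) ln (cosh (s * (i%:R + 2^-1)))).
  rewrite expR_sum [RHS](reindex_inj rev_ord_inj) /=; apply: eq_bigr => i _.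
  rewrite lnK ?posrE ?cosh_gt0// /tilt natrB// -(natr1 i).
  by congr (cosh (s * _)); field.
by rewrite -expRM_natl.
Qed.

Lemma prod_tilt_le sigma m N : 0 <= sigma -> (0 < m <= N)%N ->
  (\prod_(i < m) cosh (tilt (sigma / N%:R) m i)) ^+ 2 <=
  expR (sigma + 2 * m%:R ^+ 2 / N%:R * G sigma).
Proof.
move=> s0 /andP[m0 mN]; rewrite prod_tilt ler_expR.
have mR : 0 < m%:R :> R by rewrite ltr0n.
have NR : 0 < N%:R :> R by rewrite ltr0n (leq_trans m0).
have mN1 : 0 <= (m%:R / N%:R : R) <= 1.
  by rewrite divr_ge0//= ler_pdivrMr// mul1r ler_nat.
have := G_midpoint s0 m0; rewrite ler_norml => /andP[+ _].
set S := \sum_(i < m) ln (cosh (sigma * _)) => HS.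
have : \sum_(i < m) ln (cosh (sigma / N%:R * (i%:R + 2^-1))) <= m%:R / N%:R * S.
  rewrite mulr_sumr; apply: ler_sum => i _.
  have -> : sigma / N%:R * (i%:R + 2^-1) =
    m%:R / N%:R * (sigma * ((i%:R + 2^-1) / m%:R)) by field; rewrite !gt_eqF.
  exact: ln_cosh_scale.
have -> : 2 * m%:R ^+ 2 / N%:R * G sigma = m%:R / N%:R * (2 * m%:R * G sigma).
  by field; rewrite gt_eqF.
have /andP[t0 t1] := mN1; move: t0 t1 HS.
move: (m%:R / N%:R) (2 * m%:R * G sigma) => t GG t0 t1 HS; nra.
Qed.

Lemma prod_tilt_ge sigma N : 0 <= sigma -> (0 < N)%N ->
  expR (2 * N%:R * G sigma - sigma) <=
  (\prod_(i < N) cosh (tilt (sigma / N%:R) N i)) ^+ 2.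
Proof.
move=> s0 N0; rewrite prod_tilt ler_expR.
have := G_midpoint s0 N0; rewrite ler_norml => /andP[_].
rewrite (eq_bigr (fun i : 'I_N => ln (cosh (sigma / N%:R * (i%:R + 2^-1))))) => [|i _].
  lra.
by congr (ln (cosh _)); rewrite mulrAC mulrA.
Qed.

(** An excursion of length j = k + 1 feels fields scaled by j / (2 N), and by
    convexity this factor comes out in front of j G. The additional factor of
    order N^(-1/2) for the long excursions is the upper half of a local limit
    theorem: the killed walk has to meet its time reversal. *)
Lemma excursion_le sigma k N : 0 <= sigma -> (k < 2 * N)%N ->
  pweight 0 (sigma / N%:R) k 0 <=
    expR (sigma + k.+1%:R ^+ 2 / (2 * N)%:R * G sigma) /\
  ((N <= k)%N -> pweight 0 (sigma / N%:R) k 0 <=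
    (Num.sqrt (1 + N%:R / (32 * cosh sigma ^+ 2)))^-1 *
    expR (sigma + k.+1%:R ^+ 2 / (2 * N)%:R * G sigma)).
Proof.
move=> s0 kN; have [kodd|keven] := boolP (odd k); last first.
  have -> : pweight 0 (sigma / N%:R) k 0 = 0 by rewrite pweight_parity// addn0.
  split=> [|_]; first exact: expR_ge0.
  by rewrite mulr_ge0 ?expR_ge0 ?invr_ge0 ?sqrtr_ge0.
have [n kE] : exists n, k = (2 * n).+1.
  by exists k./2; have := odd_double_half k; rewrite kodd -muln2; lia.
subst k; have nN : (n < N)%N by lia.
have NR : 0 < N%:R :> R by rewrite ltr0n; lia.
set s := sigma / N%:R.
have s_ge0 : 0 <= s by rewrite divr_ge0// ltW.
have -> : (2 * n).+2%:R ^+ 2 / (2 * N)%:R * G sigma =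
    2 * n.+1%:R ^+ 2 / N%:R * G sigma.
  rewrite natrM (_ : (2 * n).+2 = (2 * n.+1)%N) ?natrM; last by lia.
  by field; rewrite gt_eqF.
rewrite (@excursion_square _ s n (2 * n).+4)//.
have mN : (0 < n.+1 <= N)%N by lia.
have nM : (n.+1 < (2 * n).+4)%N by lia.
have P := prod_tilt_le s0 mN; rewrite -/s in P.
split=> [|Nn]; first exact: le_trans (kwalk_energy_le_prod _ nM) P.
have hs i : (i < n.+1)%N -> `|tilt s n.+1 i| <= sigma.
  move=> ik; have iR : i.+1%:R <= n.+1%:R :> R by rewrite ler_nat.
  have nR : n.+1%:R <= N%:R :> R by rewrite ler_nat.
  rewrite -natr1 in iR; rewrite ger0_norm; last by rewrite mulr_ge0//; lra.
  rewrite -[leRHS](divfK (lt0r_neq0 NR)) ler_wpM2l//.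
  by have := ler0n R i; lra.
have E := kwalk_energy_le nM hs.
set E2 := \sum_(y < _) _ in E *; set Q := \prod_(_ < _) _ in E P.
have C1 := cosh_ge1 sigma.
set C := cosh sigma in C1 E *.
have C20 : 0 < C ^+ 2 by rewrite exprn_gt0//; lra.
have E20 : 0 <= E2 by apply: sumr_ge0 => *; exact: sqr_ge0.
have q0 : 0 < 1 + N%:R / (32 * C ^+ 2).
  by rewrite addr_gt0// divr_gt0// mulr_gt0.
(* a long excursion has a middle time n + 1 >= N / 2 *)
have Nn2 : N%:R / (32 * C ^+ 2) <= n.+1%:R / (16 * C ^+ 2).
  have -> : n.+1%:R / (16 * C ^+ 2) = (2 * n.+1%:R) / (32 * C ^+ 2).
    by field; rewrite gt_eqF//; lra.
  have : N%:R <= (2 * n.+1)%:R :> R by rewrite ler_nat; apply: leq_trans Nn _; rewrite mulnS.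
  by rewrite natrM ler_pM2r// invr_gt0 mulr_gt0.
rewrite mulrC ler_pdivlMr ?sqrtr_gt0//; apply: le_trans P.
have Eq0 : 0 <= E2 * Num.sqrt (1 + N%:R / (32 * C ^+ 2)).
  by rewrite mulr_ge0 ?sqrtr_ge0.
rewrite -ler_sqr ?nnegrE ?sqr_ge0// exprMn sqr_sqrtr ?(ltW q0)// -exprM.
by apply: le_trans E; rewrite ler_wpM2l ?sqr_ge0// lerD2l.
Qed.

(** The function [r ^ y] is harmonic for the free walk up to the factor
    [(r + 1/r)/2], so the discounted weights of the excursions add up to a
    return probability. *)
Lemma sum_excursions_harmonic (r a : R) k : 0 < r -> a = (r + r^-1) / 2 ->
  \sum_(i < k) pweight 0 0 i 0 * a ^- i.+1 <= r / (2 * a).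
Proof.
move=> r0 aE; have a0 : 0 < a by rewrite aE divr_gt0// addr_gt0 ?invr_gt0.
pose T j := \sum_(y < k.+3) r ^+ y * pweight 0 0 j y.
have T0 : T 0%N = r / 2.
  rewrite /T 2!big_ord_recl big1 => [|i _]; last by rewrite /= mulr0.
  by rewrite /= mul0r expR0 expr1 mulr0 add0r addr0 mul1r.
have TS j : (j < k)%N -> T j.+1 = a * (T j - pweight 0 0 j 0).
  move=> jk; rewrite /T (@transfer_adjoint _ _ _ (pweight 0 0 j) (fun y => r ^+ y)); last first.
    by move=> y My; apply: pweight_supp; lia.
  rewrite [LHS]big_ord_recl [in RHS]big_ord_recl /= expr0 mul1r addrAC subrr add0r.
  have up0 : up 0 0 0 = 0 :> R by rewrite /up /leave eqxx mul0r.
  have upS z : up 0 0 z.+1 = 2^-1 :> R by rewrite /up leaveS !mul0r expR0 !mul1r.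
  have downS z : down 0 0 z.+1 = 2^-1 :> R by rewrite /down leaveS !mul0r expR0 !mul1r.
  rewrite up0 mul0r addr0 mulr0 add0r mulr_sumr.
  apply: eq_bigr => i _; rewrite /bump leq0n add1n upS downS add0n.
  by rewrite aE !exprS; field; rewrite gt_eqF.
suff H j : (j <= k)%N -> \sum_(i < j) pweight 0 0 i 0 * a ^- i.+1 = r / (2 * a) - T j * a ^- j.+1.
  rewrite H// gerBl mulr_ge0//; last by rewrite invr_ge0 exprn_ge0// ltW.
  by apply: sumr_ge0 => y _; rewrite mulr_ge0 ?pweight_ge0// exprn_ge0// ltW.
elim: j => [|j IHj] jk.
  by rewrite big_ord0 T0 expr1; field; rewrite gt_eqF.
rewrite big_ord_recr /= IHj ?(ltnW jk)// TS// (exprS a j.+1).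
have aj : a ^+ j.+1 != 0 by rewrite expf_neq0// gt_eqF.
by field; rewrite aj gt_eqF.
Qed.

(** F is the free energy at zero area: at F, the excursions weighted by
    lambda form a (sub)probability, so that the contacts form a renewal
    process. *)
Lemma sum_excursions_le1 lam (Gam : R) k : 0 <= lam -> F lam <= Gam ->
  lam * \sum_(i < k) pweight 0 0 i 0 * expR (- (i.+1%:R * Gam)) <= 1.
Proof.
move=> l0 FG.
suff [r [r0 rF rl]] : exists r : R, [/\ 0 < r,
    expR (F lam) = (r + r^-1) / 2 & lam * (r / (2 * ((r + r^-1) / 2))) <= 1].
  apply: le_trans rl; rewrite ler_wpM2l//.
  rewrite -rF; apply: le_trans (sum_excursions_harmonic k r0 rF).
  apply: ler_sum => i _; rewrite ler_wpM2l ?pweight_ge0//.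
  by rewrite -expRM_natl -expRN ler_expR lerN2 ler_wpM2l.
rewrite /F; case: ifPn => [l2|]; last first.
  rewrite -leNgt => l2; exists 1; rewrite invr1 expR0; split=> //; first by field.
  by rewrite (_ : _ * _ = lam / 2); [lra|field].
set q := Num.sqrt (lam - 1).
have q0 : 0 < q by rewrite sqrtr_gt0; lra.
have q2 : lam = q ^+ 2 + 1 by rewrite sqr_sqrtr; lra.
have qn : q != 0 by rewrite gt_eqF.
exists q^-1; split; first by rewrite invr_gt0.
  have lq0 : 0 < lam / (2 * q) by apply: divr_gt0; lra.
  rewrite lnK ?posrE//.
  by rewrite q2 invrK; field.
have -> : lam * (q^-1 / (2 * ((q^-1 + q^-1^-1) / 2))) = 1 => //.
by rewrite q2 invrK; field; rewrite qn; apply/eqP; have := sqr_ge0 q; lra.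
Qed.

End ExcursionWeights.

(** * Bounds for the partition function *)

Section PartitionFunction.
Variable R : realType.
Implicit Types (lam sigma g Gam : R) (k m n N M : nat).

Let sum_sqr_expR_le (c : R) n : 0 < c ->
  \sum_(i < n) i.+1%:R ^+ 2 * expR (- (c * i.+1%:R)) <= 32 / c ^+ 3.
Proof.
move=> c0; have c20 : 0 < c / 2 by rewrite divr_gt0.
apply: le_trans (_ : \sum_(i < n) 16 / c ^+ 2 * expR (- (c / 2 * i.+1%:R)) <= _).
  apply: ler_sum => i _; set x : R := i.+1%:R.
  have x0 : 0 <= x by exact: ler0n.
  have -> : expR (- (c * x)) = expR (- (c / 2 * x)) * expR (- (c / 2 * x)).
    by rewrite -expRD; congr expR; field.
  rewrite mulrA ler_pM2r ?expR_gt0//.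
  rewrite expRN -ler_pdivlMr ?invr_gt0 ?expR_gt0// invrK.
  rewrite mulrAC ler_pdivlMr ?exprn_gt0//.
  (* half of the decay absorbs x^2, because c x / 4 <= exp (c x / 4) *)
  have -> : expR (c / 2 * x) = expR (c * x / 4) ^+ 2.
    by rewrite expr2 -expRD; congr expR; field.
  have : c * x / 4 <= expR (c * x / 4).
    by have := expR_ge1Dx (c * x / 4); lra.
  have : 0 <= c * x / 4 by rewrite divr_ge0 ?mulr_ge0// ltW.
  move: (expR _) => e; have -> : x ^+ 2 * c ^+ 2 = 16 * (c * x / 4) ^+ 2 by field.
  by move: (c * x / 4) => t; nra.
rewrite -mulr_sumr.
have -> : 32 / c ^+ 3 = 16 / c ^+ 2 * (c / 2)^-1 by field; rewrite gt_eqF.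
by rewrite ler_wpM2l ?divr_ge0 ?exprn_ge0 ?(ltW c0)// sum_geometric_le.
Qed.

(** The contribution of the area to the short excursions is a perturbation of
    relative size (k + 1)^2 / N, summable against their exponential decay. *)
Let sum_short_excursions lam sigma Gam (c : R) N : (0 < N)%N -> 0 <= lam ->
  0 <= sigma -> F lam <= Gam -> 0 < c ->
  (forall k, (k < N)%N -> pweight 0 (sigma / N%:R) k 0 * expR (- (k.+1%:R * Gam))
     <= expR sigma * expR (- (c * k.+1%:R))) ->
  lam * \sum_(i < N) pweight 0 (sigma / N%:R) i 0 * expR (- (i.+1%:R * Gam))
    <= 1 + lam * sigma * expR sigma * (32 / c ^+ 3) / N%:R.
Proof.
move=> N0 l0 s0 FG c0 H; have NR : 0 < N%:R :> R by rewrite ltr0n.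
set s := sigma / N%:R in H *; have ss0 : 0 <= s by rewrite divr_ge0// ltW.
have step (i : 'I_N) : pweight 0 s i 0 * expR (- (i.+1%:R * Gam)) <=
    pweight 0 0 i 0 * expR (- (i.+1%:R * Gam)) +
    s * expR sigma * (i.+1%:R ^+ 2 * expR (- (c * i.+1%:R))).
  have A := pweight_area_le i 0 (lexx 0) ss0.
  have K0 : 0 <= pweight 0 s i 0 by exact: pweight_ge0.
  have B : pweight 0 s i 0 <= pweight 0 0 i 0 + s * i.+1%:R ^+ 2 * pweight 0 s i 0.
    have E := expR_ge1Dx (- (s * i.+1%:R ^+ 2)).
    have : expR (- (s * i.+1%:R ^+ 2)) * pweight 0 s i 0 <= pweight 0 0 i 0.
      by rewrite expRN mulrC ler_pdivrMr ?expR_gt0// mulrC.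
    by have := ler_wpM2r K0 E; lra.
  have {}H := H i (ltn_ord i).
  have e0 := expR_ge0 (- (i.+1%:R * Gam)).
  have := ler_wpM2r e0 B; rewrite mulrDl => /le_trans; apply.
  rewrite lerD2l.
  have -> : s * i.+1%:R ^+ 2 * pweight 0 s i 0 * expR (- (i.+1%:R * Gam)) =
    s * i.+1%:R ^+ 2 * (pweight 0 s i 0 * expR (- (i.+1%:R * Gam))) by ring.
  have -> : s * expR sigma * (i.+1%:R ^+ 2 * expR (- (c * i.+1%:R))) =
    s * i.+1%:R ^+ 2 * (expR sigma * expR (- (c * i.+1%:R))) by ring.
  by rewrite ler_wpM2l// mulr_ge0 ?sqr_ge0.
apply: le_trans (ler_wpM2l l0 (ler_sum _ (fun i _ => step i))) _.
rewrite big_split mulrDr /=; apply: lerD; first exact: sum_excursions_le1.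
rewrite -mulr_sumr.
have -> : lam * sigma * expR sigma * (32 / c ^+ 3) / N%:R =
  lam * (s * expR sigma * (32 / c ^+ 3)) by rewrite /s; field; rewrite !gt_eqF.
rewrite ler_wpM2l// ler_wpM2l ?mulr_ge0 ?expR_ge0//; exact: sum_sqr_expR_le.
Qed.

(** The first term accounts for the paths whose excursions are all short; the
    second one for an excursion covering more than half of the path, whose
    length differs from 2 N by O(1) because G is convex. *)
Lemma partition_le lam sigma Gam g : 0 <= lam -> 0 <= sigma -> F lam <= Gam ->
  G sigma <= g -> Gam <= g < 2 * Gam ->
  exists2 C : R, 0 < C & forall n (B : R), 0 <= B ->
    (forall k, (n.+1 <= k < 2 * n.+1)%N -> pweight 0 (sigma / n.+1%:R) k 0 <=
      B * expR (sigma + k.+1%:R ^+ 2 / (2 * n.+1)%:R * G sigma)) ->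
    pweight lam (sigma / n.+1%:R) (2 * n).+1 0 <=
      C * (expR (2 * n.+1%:R * Gam) + B * expR (2 * n.+1%:R * g)).
Proof.
move=> l0 s0 FG Gg /andP[Gamg gGam].
(* An excursion of length j <= N has j / (2 N) <= 1/2, so that its rate is at
   most g / 2. For j > N the decay rate in 2 N - j is 3 g / 2 - Gam, which is at
   least c since Gam <= g. *)
pose c := Gam - g / 2.
have c0 : 0 < c by rewrite /c; lra.
pose D := lam * sigma * expR sigma * (32 / c ^+ 3).
have c30 : 0 <= 32 / c ^+ 3 by rewrite divr_ge0// exprn_ge0// ltW.
have D0 : 0 <= D by rewrite mulr_ge0// mulr_ge0 ?expR_ge0// mulr_ge0.
pose A := expR sigma; have A0 : 0 < A by exact: expR_gt0.
pose E := (1 + lam * (expR (2 * D) * (A / c)) * (expR c / c)) * (expR c / c).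
have Ac0 : 0 < A / c by rewrite divr_gt0.
have cc0 : 0 <= expR c / c by rewrite divr_ge0 ?expR_ge0// ltW.
have E0 : 0 <= E.
  have L0 : 0 <= lam * (expR (2 * D) * (A / c)).
    by rewrite mulr_ge0// mulr_ge0 ?expR_ge0// ltW.
  by rewrite mulr_ge0// addr_ge0// mulr_ge0.
exists (expR (2 * D) * (A / c + E * A)).
  by rewrite mulr_gt0 ?expR_gt0// ltr_pwDl// mulr_ge0// ltW.
move=> n B B0 HB; set N := n.+1; have NR : 0 < N%:R :> R by rewrite ltr0n.
set s := sigma / N%:R in HB *.
pose T : R := (2 * N)%:R; have TE : T = 2 * N%:R by rewrite /T natrM.
have T0 : 0 < T by rewrite TE mulr_gt0.
pose w k := expR (- (k.+1%:R * Gam)).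
have expo k : (k < 2 * N)%N ->
    expR (sigma + k.+1%:R ^+ 2 / T * G sigma) * w k <=
    A * expR (k.+1%:R * (k.+1%:R / T * g - Gam)).
  move=> kN; rewrite /w /A -!expRD ler_expR.
  have : k.+1%:R ^+ 2 / T * G sigma <= k.+1%:R ^+ 2 / T * g.
    by rewrite ler_wpM2l// divr_ge0 ?sqr_ge0// ltW.
  lra.
have short k : (k < N)%N -> pweight 0 s k 0 * w k <= A * expR (- (c * k.+1%:R)).
  move=> kN; have kN2 : (k < 2 * N)%N by move: kN; clear; lia.
  have [+ _] := excursion_le s0 kN2; rewrite -/s -/T => H.
  apply: le_trans (ler_wpM2r (expR_ge0 _) H) _; apply: le_trans (expo k kN2) _.
  rewrite ler_pM2l// ler_expR -mulNr mulrC ler_wpM2r//.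
  have : k.+1%:R / T <= 2^-1 :> R.
    rewrite ler_pdivrMr// TE mulKf//; first by rewrite ler_nat.
  have g0 : 0 <= g by lra.
  by move=> /(ler_wpM2r g0); rewrite /c; lra.
have long k : (N <= k < 2 * N)%N -> pweight 0 s k 0 * w k <=
    B * A * expR (T * (g - Gam)) * expR (- (c * (T - k.+1%:R))).
  move=> /andP[Nk kN]; have H := HB k; rewrite Nk kN in H.
  apply: le_trans (ler_wpM2r (expR_ge0 _) (H isT)) _.
  rewrite -[leLHS]mulrA -[leRHS]mulrA -[leRHS]mulrA ler_wpM2l//.
  apply: le_trans (expo k kN) _.
  rewrite ler_pM2l// -expRD ler_expR.
  set d := T - k.+1%:R; have -> : k.+1%:R = T - d :> R by rewrite /d opprB addrC subrK.
  have d0 : 0 <= d by rewrite /d subr_ge0 ler_nat.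
  have dT : d / T <= 2^-1.
    rewrite ler_pdivrMr// TE mulKf//.
    have : N%:R <= k.+1%:R :> R by rewrite ler_nat ltnW.
    by rewrite /d TE; lra.
  have dTg : d * (d / T * g) <= d * (2^-1 * g).
    by rewrite ler_wpM2l// ler_wpM2r//; lra.
  have -> : (T - d) * ((T - d) / T * g - Gam) =
     T * (g - Gam) - d * (2 * g - Gam) + d * (d / T * g) by field; rewrite gt_eqF.
  have := mulr_ge0 d0 (_ : 0 <= g - Gam); rewrite subr_ge0 => /(_ Gamg).
  by rewrite /c; nra.
pose u k := pweight lam s k 0 * w k.
pose q k := pweight 0 s k 0 * w k.
have w0 k : 0 <= w k by exact: expR_ge0.
have wD i j : w (i + j).+1 = w i * w j.
  by rewrite /w -expRD; congr expR; rewrite -addSn -addnS natrD; ring.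
have Hu k : (k < 2 * N)%N -> u k <= q k + lam * \sum_(m < k) u m * q (k - m.+1)%N.
  move=> _; rewrite /u {1}pweight_renewal mulrDl -mulrA mulr_suml.
  rewrite lerD2l ler_wpM2l// le_eqVlt; apply/orP; left; apply/eqP.
  apply: eq_bigr => m _; rewrite /q.
  have -> : w k = w m * w (k - m.+1)%N.
    by rewrite -wD; congr w; rewrite -addSn subnKC.
  by ring.
have Hm : lam * \sum_(i < N) q i <= 1 + D / N%:R.
  exact: sum_short_excursions.
have Y0 : 0 <= B * A * expR (T * (g - Gam)).
  by rewrite mulr_ge0 ?expR_ge0// mulr_ge0// ltW.
have := @renewal_bound R N lam c D A _ u q isT l0 c0 D0 (ltW A0) Y0
  (fun k => mulr_ge0 (pweight_ge0 _ _ _ l0) (w0 k))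
  (fun k => mulr_ge0 (pweight_ge0 _ _ _ (lexx 0)) (w0 k)) Hu short long Hm (2 * n).+1.
have -> : ((2 * n).+1 < 2 * N)%N by rewrite /N mulnS.
move=> /(_ isT); set Y := B * A * _.
rewrite -[Y * _ * _]mulrA -/E /u {}/Y.
have wT : w (2 * n).+1 * expR (T * Gam) = 1.
  by rewrite /w /T -expRD (_ : (2 * n).+2 = 2 * N)%N ?addNr ?expR0// /N mulnS.
move=> /(ler_wpM2r (expR_ge0 (T * Gam))); rewrite -[X in X <= _ -> _]mulrA wT mulr1.
move/le_trans; apply.
have -> : expR (2 * D) * (A / c + B * A * expR (T * (g - Gam)) * E) * expR (T * Gam) =
  expR (2 * D) * (A / c * expR (T * Gam) + E * A * (B * (expR (T * (g - Gam)) * expR (T * Gam)))) by ring.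
rewrite -expRD (_ : T * (g - Gam) + T * Gam = T * g); last by ring.
rewrite -TE -[leRHS]mulrA ler_wpM2l ?expR_ge0//.
have X1 : 0 <= expR (T * Gam) by exact: expR_ge0.
have X2 : 0 <= B * expR (T * g) by rewrite mulr_ge0 ?expR_ge0.
have := mulr_ge0 (ltW Ac0) X2; have := mulr_ge0 (mulr_ge0 E0 (ltW A0)) X1.
move: (expR _) (B * expR _) => x y; lra.
Qed.

Let pweight_square lam (s : R) n : pweight lam s (2 * n).+1 0 =
  \sum_(y < (2 * n).+4) leave lam y * pweight lam s n y ^+ 2.
Proof.
have -> : (2 * n = n + n)%N by lia.
rewrite (@pweight_cut _ _ _ _ _ (n + n).+4)//.
by apply: eq_bigr => y _; rewrite expr2 mulrA.
Qed.

(** For lambda > 2 the eigenfunction of the pinned walk without area is square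
    summable, so that its component in the initial state has full rate. *)
Lemma pinned_ge lam : 2 < lam -> exists2 c : R, 0 < c &
  forall n, c * expR (2 * n.+1%:R * F lam) <= pweight lam 0 (2 * n).+1 0.
Proof.
move=> l2; have l0 : 0 < lam by lra.
set q := Num.sqrt (lam - 1).
have q0 : 0 < q by rewrite sqrtr_gt0; lra.
have q2 : lam = q ^+ 2 + 1 by rewrite sqr_sqrtr; lra.
have qn : q != 0 by rewrite gt_eqF.
pose r := q^-1; have r0 : 0 < r by rewrite invr_gt0.
have rn : r != 0 by rewrite gt_eqF.
pose a := expR (F lam).
have aE : a = (r + r^-1) / 2.
  rewrite /a /F l2 lnK ?posrE; last by apply: divr_gt0; rewrite -/q; lra.
  by rewrite -/q [in lam / _]q2 /r invrK; field.
have aE' : a = lam * r / 2 by rewrite aE q2 /r invrK; field.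
(* the eigenfunction, normalised so that [leave lam 0 * psi 0 = 1] *)
pose psi (y : nat) := if y == 0%N then lam^-1 else r ^+ y.
have psi0 : leave lam 0 * psi 0%N = 1 by rewrite /leave /psi /= mulfV ?gt_eqF.
have psiE z : psi z.+1 = r ^+ z.+1 by [].
have psiS z : leave lam z.+1 * psi z.+1 = r ^+ z.+1 by rewrite leaveS mul1r.
have eig k M : (k.+2 < M)%N ->
    \sum_(y < M) leave lam y * psi y * pweight lam 0 k y = a ^+ k.+1 / lam.
  elim: k => [|k IHk] kM.
    case: M kM => [|[|M]]// kM; rewrite 2!big_ord_recl big1 => [|i _]; last first.
      by rewrite /= mulr0.
    have e1 : leave lam 1 * psi 1%N * pweight lam 0 0 1 = r / 2.
      by rewrite psiS /= mul0r expR0 expr1 mul1r.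
    rewrite addr0 [X in X + _](_ : _ = 0) ?add0r; last by rewrite /= mulr0.
    by apply: etrans e1 _; rewrite aE' expr1; field; rewrite gt_eqF.
  rewrite (@transfer_adjoint _ _ _ (pweight lam 0 k) (fun y => leave lam y * psi y)); last first.
    by move=> y My; apply: pweight_supp; lia.
  rewrite (exprS a k.+1) -mulrA -(IHk (ltnW kM)) mulr_sumr; apply: eq_bigr => i _.
  have upE z : up lam 0 z = leave lam z / 2 by rewrite /up mul0r expR0 mul1r.
  have downE z : down lam 0 z = leave lam z / 2 by rewrite /down mul0r expR0 mul1r.
  rewrite upE downE; case: (nat_of_ord i) => [|[|z]].
  - by rewrite psi0 psiS /leave eqxx aE' expr1; ring.
  - by rewrite psi0 !psiS leaveS aE expr2 expr1; field.
  - by rewrite !psiS leaveS aE !exprS; field.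
have r21 : 0 < 1 - r ^+ 2.
  rewrite subr_gt0 /r exprVn invf_lt1 ?exprn_gt0//; lra.
pose K := lam^-1 + (1 - r ^+ 2)^-1.
have K0 : 0 < K by rewrite addr_gt0 ?invr_gt0.
have sumpsi M : \sum_(y < M) leave lam y * psi y ^+ 2 <= K.
  case: M => [|M]; first by rewrite big_ord0 ltW.
  rewrite big_ord_recl; apply: lerD.
    by rewrite expr2 mulrA psi0 mul1r.
  apply: le_trans (_ : \sum_(i < M) (r ^+ 2) ^+ i <= _).
    apply: ler_sum => i _; rewrite lift0 leaveS mul1r psiE.
    rewrite [leLHS]exprAC (exprS (r ^+ 2)) ler_piMl ?exprn_ge0 ?sqr_ge0//; lra.
  rewrite -[leRHS]mul1r ler_pdivlMr// mulrC.
  have -> : (1 - r ^+ 2) * \sum_(i < M) (r ^+ 2) ^+ i = 1 - (r ^+ 2) ^+ M.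
    by rewrite -opprB mulNr -subrX1 opprB.
  by rewrite gerBl exprn_ge0// sqr_ge0.
exists (lam ^- 2 / K); first by rewrite divr_gt0// invr_gt0 exprn_gt0.
move=> n; have := @weighted_cauchy_schwarz R (2 * n).+4 (leave lam) psi
  (pweight lam 0 n) (fun z => leave_ge0 z (ltW l0)).
rewrite -pweight_square eig; last by lia.
rewrite -[2 * _ * _]mulrA expRM_natl expRM_natl -/a -exprM.
have -> : (a ^+ n.+1 / lam) ^+ 2 = lam ^- 2 * a ^+ (n.+1 * 2).
  by rewrite exprMn -exprM exprVn mulrC.
move=> H; rewrite mulrAC ler_pdivrMr//; apply: le_trans H _.
by rewrite mulrC ler_wpM2l// pweight_ge0// ltW.
Qed.

(** For lam <= 2 the excursions without area, weighted by lam, form a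
    subprobability, and the renewal equation preserves the bound 1. *)
Lemma no_area_le lam k : 0 <= lam <= 2 -> pweight lam 0 k 0 <= 1.
Proof.
move=> /andP[l0 l2].
have F0 : F lam = 0 by rewrite /F ltNge l2.
have mass j : lam * \sum_(i < j) pweight 0 0 i 0 <= 1.
  have := @sum_excursions_le1 R lam 0 j l0; rewrite F0 lexx => /(_ isT).
  by under eq_bigr do rewrite mulr0 oppr0 expR0 mulr1.
have half j : \sum_(i < j) pweight 0 0 i 0 <= 1 :> R.
  have := @sum_excursions_harmonic R 1 1 j ltr01.
  rewrite invr1 => /(_ ltac:(by field)).
  under eq_bigr do rewrite expr1n invr1 mulr1.
  by lra.
have := @discrete_gronwall R k.+1 0 (fun k => pweight lam 0 k 0)
  (fun k => pweight 0 0 k 0) (lexx 0) (fun k => pweight_ge0 _ _ _ (lexx 0)).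
rewrite addr0 => /(_ _ k (ltnSn k)) H; apply: le_trans (H _) _; last first.
  by rewrite expr1n mul1r half.
move=> {H} j M _ M0 uM; rewrite pweight_renewal addrC lerD2r mul1r.
apply: le_trans (_ : (lam * \sum_(i < j) pweight 0 0 i 0) * M <= _); last first.
  by rewrite -[leRHS]mul1r ler_wpM2r.
rewrite -mulrA ler_wpM2l// mulr_suml [leRHS](reindex_inj rev_ord_inj) /=.
apply: ler_sum => m _; rewrite mulrC ler_wpM2l ?pweight_ge0//; exact: uM.
Qed.

(** Without area, the height is harmonic for the walk killed at 0, so that the
    weight of an excursion decays polynomially. *)
Lemma no_area_ge n : (4 * (2 * n).+4%:R ^+ 3)^-1 <= pweight 0 0 (2 * n).+1 0 :> R.
Proof.
have harm k M : (k.+2 < M)%N ->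
    \sum_(y < M) y%:R * pweight 0 0 k y = 2^-1 :> R.
  elim: k => [|k IHk] kM.
    case: M kM => [|[|M]]// kM; rewrite 2!big_ord_recl big1 => [|i _]; last first.
      by rewrite /= mulr0.
    by rewrite /= !mul0r expR0 add0r addr0 !mul1r.
  rewrite (@transfer_adjoint _ _ _ (pweight 0 0 k) (fun y => y%:R)); last first.
    by move=> y My; apply: pweight_supp; lia.
  rewrite -(IHk (ltnW kM)); apply: eq_bigr => i _; rewrite mulrC; congr (_ * _).
  rewrite /up /down; case: (nat_of_ord i) => [|z].
    by rewrite /leave eqxx !mul0r addr0.
  by rewrite leaveS !mul0r expR0 !mul1r -!natr1; field.
have := @weighted_cauchy_schwarz R (2 * n).+4 (leave 0) (fun y => y%:R)
  (pweight 0 0 n) (fun z => leave_ge0 z (lexx 0)).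
have -> : \sum_(i < (2 * n).+4) leave 0 i * i%:R * pweight 0 0 n i = 2^-1 :> R.
  rewrite -(@harm n (2 * n).+4); last by lia.
  by apply: eq_bigr => -[[|i] iM] _; rewrite [nat_of_ord _]/= ?leaveS ?mul1r// mulr0.
rewrite -pweight_square; set S := pweight _ _ _ _ => CS.
have S0 : 0 <= S by exact: pweight_ge0.
set M : R := (2 * n).+4%:R; have M0 : 0 < M by rewrite ltr0n.
have : \sum_(i < (2 * n).+4) leave 0 i * i%:R ^+ 2 <= M ^+ 3.
  apply: le_trans (_ : \sum_(i < (2 * n).+4) M ^+ 2 <= _).
    apply: ler_sum => i _; rewrite -[leRHS]mul1r; apply: ler_pM.
    - exact: leave_ge0.
    - exact: sqr_ge0.
    - by rewrite /leave; case: ifP.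
    - by apply: lerXn2r; rewrite ?nnegrE// ler_nat ltnW.
  by rewrite sumr_const card_ord -(mulr_natr (M ^+ 2)) -/M -exprSr.
move=> /(ler_wpM2r S0) /(le_trans CS) H.
rewrite -[leLHS]mul1r ler_pdivrMr ?mulr_gt0 ?exprn_gt0//; nra.
Qed.

End PartitionFunction.

(** * The two phases *)

Section Asymptotics.
Variable R : realType.
Implicit Types (lam sigma : R) (n N : nat).

Lemma F_gt0 lam : 2 < lam -> 0 < F lam.
Proof.
move=> l2; rewrite /F l2; apply: ln_gt0.
set q := Num.sqrt (lam - 1).
have q1 : 1 < q by rewrite -[ltLHS]sqrtr1 ltr_sqrt; lra.
have -> : lam = q ^+ 2 + 1 by rewrite sqr_sqrtr; lra.
rewrite ltr_pdivlMr; last by lra.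
by have : 0 < (q - 1) ^+ 2; [rewrite exprn_gt0// subr_gt0|nra].
Qed.

Lemma F_ge0 lam : 0 <= F lam.
Proof. by have [/F_gt0/ltW//|l2] := ltP 2 lam; rewrite /F ltNge l2. Qed.

Let two_sided (x : nat -> R) (a b : R) : 0 < a -> 0 < b ->
  (forall n, a <= x n.+1 <= b) ->
  exists2 C : R, 0 < C & forall N, (1 <= N)%N -> C^-1 <= x N <= C.
Proof.
move=> a0 b0 H; have aV : 0 < a^-1 by rewrite invr_gt0.
exists (a^-1 + b); first exact: addr_gt0.
case=> // n _; have /andP[ax xb] := H n; apply/andP; split; last by lra.
apply: le_trans ax; rewrite -[leRHS]invrK lef_pV2 ?posrE//; [by lra|exact: addr_gt0].
Qed.

(** The rate Gam lies strictly between max (F, G/2) and G: the paths with only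
    short excursions are then exponentially negligible, even against the
    prefactor N^(-1/2). *)
Lemma desorbed_asymptotics lam sigma : 0 <= lam -> 0 <= sigma ->
  F lam < G sigma ->
  exists2 C : R, 0 < C & forall N, (1 <= N)%N ->
    C^-1 <= Num.sqrt N%:R * Z N lam sigma / expR (2 * N%:R * G sigma) <= C.
Proof.
move=> l0 s0 FG; have Fl := F_ge0 lam.
have G0 : 0 < G sigma by lra.
have sigma0 : 0 < sigma.
  by rewrite lt0r s0 andbT; apply/eqP => s00; move: G0; rewrite s00 G0 ltxx.
pose Gam := (Num.max (F lam) (G sigma / 2) + G sigma) / 2.
have maxF : F lam <= Num.max (F lam) (G sigma / 2) by rewrite le_max lexx.
have maxG2 : G sigma / 2 <= Num.max (F lam) (G sigma / 2).
  by rewrite le_max lexx orbT.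
have maxG : Num.max (F lam) (G sigma / 2) < G sigma.
  by rewrite gt_max FG /=; lra.
have FGam : F lam <= Gam by rewrite /Gam; lra.
have GamG : Gam < G sigma by rewrite /Gam; lra.
have G2Gam : G sigma < 2 * Gam by rewrite /Gam; lra.
clearbody Gam.
have [|C C0 HC] := partition_le l0 s0 FGam (lexx (G sigma)).
  by rewrite G2Gam ltW.
pose c := (1 - expR (- sigma)) / 4.
have c0 : 0 < c by rewrite divr_gt0// subr_gt0 -expR0 ltr_expR oppr_lt0.
pose d := G sigma - Gam; have d0 : 0 < d by rewrite subr_gt0.
pose K := 32 * cosh sigma ^+ 2.
have K0 : 0 < K by rewrite mulr_gt0// exprn_gt0// cosh_gt0.
have w0 : 0 < 2 * Num.sqrt (2 / c) + 1.
  by rewrite ltr_wpDl// mulr_ge0 ?sqrtr_ge0.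
apply: (@two_sided (fun N => Num.sqrt N%:R * Z N lam sigma / expR (2 * N%:R * G sigma))
  (c ^+ 2 / 4 * expR (- sigma) / (2 * Num.sqrt (2 / c) + 1))
  (C * ((2 * d)^-1 + Num.sqrt K))).
- by rewrite divr_gt0// mulr_gt0 ?expR_gt0// divr_gt0// exprn_gt0.
- by rewrite mulr_gt0// ltr_wpDr ?sqrtr_ge0// invr_gt0 mulr_gt0.
move=> n; rewrite Z_pweight; set N := n.+1.
have NR : 0 < N%:R :> R by rewrite ltr0n.
have N1 : 1 <= N%:R :> R by rewrite ler1n.
set q := Num.sqrt N%:R.
have q1 : 1 <= q by rewrite -[leLHS]sqrtr1 ler_sqrt// ltW.
have q2 : q ^+ 2 = N%:R by rewrite sqr_sqrtr// ltW.
set s := sigma / N%:R.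
set z := pweight lam s _ 0.
apply/andP; split.
  rewrite ler_pdivlMr ?expR_gt0// mulrAC ler_pdivrMr//.
  have s00 : 0 < s by rewrite divr_gt0.
  have cE : c = (1 - expR (- (s * N%:R))) / 4 by rewrite /s divfK// gt_eqF.
  have := @excursion_ge R s c n s00 cE; rewrite -/N.
  have := prod_tilt_ge s0 (ltn0Sn n); rewrite -/N -/s.
  set P := (\prod_(_ < _) _) ^+ 2; rewrite expRD => PE.
  have -> : Num.sqrt (2 * N%:R / c) = q * Num.sqrt (2 / c).
    have c20 : 0 <= 2 / c by rewrite divr_ge0// ltW.
    by rewrite mulrAC (sqrtrM _ c20) mulrC.
  have : pweight 0 s (2 * n).+1 0 <= z by apply: ler_pweight; rewrite ?lexx.
  have := pweight_ge0 s (2 * n).+1 0 (lexx (0 : R)).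
  move: (pweight 0 s (2 * n).+1 0) => x x0 xz H.
  have A : c ^+ 2 / 4 * (expR (2 * N%:R * G sigma) * expR (- sigma)) <=
    (2 * (q * Num.sqrt (2 / c)) + 1) * x.
    by apply: le_trans H; rewrite ler_wpM2l// divr_ge0// exprn_ge0// ltW.
  have -> : c ^+ 2 / 4 * expR (- sigma) * expR (2 * N%:R * G sigma) =
    c ^+ 2 / 4 * (expR (2 * N%:R * G sigma) * expR (- sigma)) by ring.
  apply: le_trans A _.
  have -> : q * z * (2 * Num.sqrt (2 / c) + 1) =
     (2 * (q * Num.sqrt (2 / c)) + q) * z by ring.
  apply: ler_pM => //; last by rewrite lerD2l.
  by rewrite addr_ge0// mulr_ge0// mulr_ge0 ?sqrtr_ge0//; lra.
rewrite ler_pdivrMr ?expR_gt0//.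
pose B := (Num.sqrt (1 + N%:R / K))^-1.
have B0 : 0 <= B by rewrite invr_ge0 sqrtr_ge0.
have HB k : (n.+1 <= k < 2 * n.+1)%N -> pweight 0 (sigma / n.+1%:R) k 0 <=
      B * expR (sigma + k.+1%:R ^+ 2 / (2 * n.+1)%:R * G sigma).
  by move=> /andP[nk kn]; have [_] := excursion_le s0 kn; apply.
have := HC n B B0 HB; rewrite -/N -/s -/z => Hz.
have qB : q * B <= Num.sqrt K.
  have NK : 0 < 1 + N%:R / K by rewrite addr_gt0// divr_gt0.
  rewrite ler_pdivrMr ?sqrtr_gt0// -sqrtrM ?(ltW K0)// ler_sqrt.
    by rewrite mulrDr mulr1 mulrCA mulfV ?gt_eqF// mulr1 lerDr ltW.
  by rewrite mulr_ge0// ltW.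
have qG : q * expR (2 * N%:R * Gam) <= (2 * d)^-1 * expR (2 * N%:R * G sigma).
  have -> : 2 * N%:R * G sigma = 2 * d * N%:R + 2 * N%:R * Gam by rewrite /d; ring.
  rewrite expRD mulrA ler_wpM2r ?expR_ge0//.
  rewrite mulrC ler_pdivlMr ?mulr_gt0//.
  have := expR_ge1Dx (2 * d * N%:R).
  have : q <= N%:R by rewrite -q2 expr2 ler_peMr//; lra.
  by nra.
have q0 : 0 <= q by lra.
apply: le_trans (ler_wpM2l q0 Hz) _.
have -> : q * (C * (expR (2 * N%:R * Gam) + B * expR (2 * N%:R * G sigma))) =
  C * (q * expR (2 * N%:R * Gam) + q * B * expR (2 * N%:R * G sigma)) by ring.
rewrite -[leRHS]mulrA ler_pM2l// [leRHS]mulrDl lerD//.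
by rewrite ler_wpM2r ?expR_ge0.
Qed.

(** Up to a constant, the full excursion has weight at most exp (2 N G), hence
    at most exp (2 N F), and can be treated like all others; dropping the area
    gives the lower bound. *)
Lemma pinned_asymptotics lam sigma : 0 <= sigma -> G sigma <= F lam -> 2 < lam ->
  exists2 C : R, 0 < C & forall N, (1 <= N)%N ->
    C^-1 <= Z N lam sigma / expR (2 * N%:R * F lam) <= C.
Proof.
move=> s0 GF l2; have F0 := F_gt0 l2; have l0 : 0 <= lam by lra.
have [|C C0 HC] := partition_le l0 s0 (lexx (F lam)) GF.
  by rewrite lexx; lra.
have [c c0 Hc] := pinned_ge l2.
apply: (@two_sided (fun N => Z N lam sigma / expR (2 * N%:R * F lam)) c (C * 2)) => //.
  by rewrite mulr_gt0.
move=> n; rewrite Z_pweight; apply/andP; split.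
  rewrite ler_pdivlMr ?expR_gt0//; apply: le_trans (Hc n) _.
  by apply: ler_pweight; rewrite ?l0 ?lexx// divr_ge0.
rewrite ler_pdivrMr ?expR_gt0//.
have H k : (n.+1 <= k < 2 * n.+1)%N -> pweight 0 (sigma / n.+1%:R) k 0 <=
    1 * expR (sigma + k.+1%:R ^+ 2 / (2 * n.+1)%:R * G sigma).
  by move=> /andP[_ kn]; have [+ _] := excursion_le s0 kn; rewrite mul1r.
apply: le_trans (HC n 1 ler01 H) _.
by rewrite le_eqVlt; apply/orP; left; apply/eqP; ring.
Qed.

(** A polynomial prefactor does not change the exponential rate. *)
Lemma rate_cvg (z : nat -> R) (M C : R) : 0 < C ->
  (forall N, (1 <= N)%N ->
     C^-1 / N%:R ^+ 3 * expR (2 * N%:R * M) <= z N <= C * expR (2 * N%:R * M)) ->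
  (fun N : nat => (2 * N)%:R^-1 * ln (z N)) @ \oo --> M.
Proof.
move=> C0 H; pose K : R := `|ln C| + 6.
have K0 : 0 < K by rewrite ltr_wpDl.
have bound N : (1 <= N)%N -> `|M - (2 * N)%:R^-1 * ln (z N)| <= K / Num.sqrt N%:R.
  move=> N1; have NR : 0 < N%:R :> R by rewrite ltr0n.
  have NR1 : 1 <= N%:R :> R by rewrite ler1n.
  have /andP[lo up] := H N N1.
  have lo0 : 0 < C^-1 / N%:R ^+ 3 * expR (2 * N%:R * M).
    by rewrite mulr_gt0 ?expR_gt0// divr_gt0 ?invr_gt0// exprn_gt0.
  have z0 : 0 < z N by exact: lt_le_trans lo.
  set q := Num.sqrt N%:R.
  have q1 : 1 <= q by rewrite -[leLHS]sqrtr1 ler_sqrt// ltW.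
  have q2 : N%:R = q ^+ 2 by rewrite sqr_sqrtr// ltW.
  have q0 : 0 < q by lra.
  have lnq : ln q <= q.
    have q1' : -1 < q - 1 by lra.
    by have := le_ln1Dx q1'; rewrite [1 + _]addrC subrK; lra.
  have lnN : ln (N%:R : R) = 2 * ln q by rewrite q2 lnXn// mulr_natl.
  move: lo up; rewrite -ler_ln ?posrE// -[_ <= C * _]ler_ln ?posrE ?mulr_gt0 ?expR_gt0//.
  rewrite !lnM ?posrE ?invr_gt0 ?divr_gt0 ?exprn_gt0 ?expR_gt0 ?invr_gt0//.
  rewrite !lnV ?posrE ?exprn_gt0// lnXn// lnN expRK -(mulr_natl (2 * _) 3).
  set L := ln (z N) => lo up.
  have -> : M - (2 * N)%:R^-1 * L = (2 * N%:R * M - L) / (2 * N%:R).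
    by rewrite natrM; field; rewrite gt_eqF.
  rewrite normrM [X in _ * X]ger0_norm ?invr_ge0 ?mulr_ge0// ler_pdivrMr ?mulr_gt0//.
  have -> : K / q * (2 * N%:R) = 2 * K * q by rewrite q2; field; rewrite gt_eqF.
  have h1 := ler_norm (ln C); have h2 := ler_norm (- ln C).
  rewrite normrN in h2.
  have aq : `|ln C| <= `|ln C| * q by rewrite ler_peMr.
  by rewrite ler_norml /K; apply/andP; split; lra.
apply/cvgrPdist_le => e e0; near=> N.
have N1 : (1 <= N)%N by near: N; exact: nbhs_infty_ge.
apply: le_trans (bound N N1) _.
have NR : 0 < N%:R :> R by rewrite ltr0n.
rewrite ler_pdivrMr ?sqrtr_gt0// mulrC -ler_pdivrMr//.
have NK : (K / e) ^+ 2 <= N%:R by near: N; exact: nbhs_infty_ger.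
by rewrite -[leLHS]ger0_norm ?divr_ge0 ?(ltW K0) ?(ltW e0)// -sqrtr_sqr ler_sqrt// ltW.
Unshelve. all: by end_near. Qed.

Lemma desorbed_rate lam sigma : 0 <= lam -> 0 <= sigma -> F lam < G sigma ->
  (fun N : nat => (2 * N)%:R^-1 * ln (Z N lam sigma)) @ \oo --> G sigma.
Proof.
move=> l0 s0 FG; have [C C0 HC] := desorbed_asymptotics l0 s0 FG.
apply: (rate_cvg C0) => N N1; have /andP[lo up] := HC N N1.
have NR : 0 < N%:R :> R by rewrite ltr0n.
have NR1 : 1 <= N%:R :> R by rewrite ler1n.
set q := Num.sqrt N%:R in lo up.
have q1 : 1 <= q by rewrite -[leLHS]sqrtr1 ler_sqrt// ltW.
have q2 : N%:R = q ^+ 2 by rewrite sqr_sqrtr// ltW.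
have q0 : 0 < q by lra.
move: lo up; rewrite ler_pdivlMr ?expR_gt0// ler_pdivrMr ?expR_gt0//.
have e0 := expR_gt0 (2 * N%:R * G sigma); set e := expR _ in e0 *.
have CV : 0 < C^-1 by rewrite invr_gt0.
move=> lo up.
have z0 : 0 <= Z N lam sigma.
  rewrite -(pmulr_rge0 _ q0); apply: le_trans lo.
  by rewrite mulr_ge0 ?ltW.
apply/andP; split; last by apply: le_trans up; rewrite ler_peMl.
rewrite mulrAC ler_pdivrMr ?exprn_gt0//; apply: le_trans lo _.
by rewrite mulrC ler_wpM2l// q2 -exprM -[leLHS]expr1 ler_weXn2l.
Qed.

Lemma pinned_rate lam sigma : 0 <= sigma -> G sigma <= F lam -> 2 < lam ->
  (fun N : nat => (2 * N)%:R^-1 * ln (Z N lam sigma)) @ \oo --> F lam.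
Proof.
move=> s0 GF l2; have [C C0 HC] := pinned_asymptotics s0 GF l2.
apply: (rate_cvg C0) => N N1; have := HC N N1.
have NR1 : 1 <= N%:R :> R by rewrite ler1n.
rewrite ler_pdivlMr ?expR_gt0// ler_pdivrMr ?expR_gt0// => /andP[lo ->].
rewrite andbT; apply: le_trans lo; rewrite ler_wpM2r ?expR_ge0//.
rewrite ler_piMr ?invr_ge0 ?(ltW C0)// invf_le1 ?exprn_gt0//; last by lra.
by rewrite exprn_ege1.
Qed.

(** The excursion of length 2 N alone bounds Z_N from below, uniformly in
    lambda >= 0. *)
Lemma critical_rate lam : 0 <= lam <= 2 ->
  (fun N : nat => (2 * N)%:R^-1 * ln (Z N lam 0)) @ \oo --> (0 : R).
Proof.
move=> l02; have /andP[l0 _] := l02.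
apply: (@rate_cvg _ 0 256); first by [].
case=> // n _; rewrite mulr0 expR0 !mulr1 Z_pweight mul0r.
have zle := no_area_le (2 * n).+1 l02.
apply/andP; split; last by lra.
apply: le_trans (_ : pweight 0 0 (2 * n).+1 0 <= _); last first.
  by apply: ler_pweight; rewrite ?l0 ?lexx.
apply: le_trans (no_area_ge R n).
rewrite -invfM lef_pV2 ?posrE ?mulr_gt0 ?exprn_gt0//.
have -> : 256 * n.+1%:R ^+ 3 = 4 * (4 * n.+1%:R) ^+ 3 :> R by ring.
rewrite ler_pM2l//; apply: lerXn2r; rewrite ?nnegrE ?mulr_ge0//.
by rewrite -natrM ler_nat; lia.
Qed.

End Asymptotics.

Theorem proposition2p1 (R : realType) (lambda sigma : R)
    (hlambda : 0 <= lambda) (hsigma : 0 <= sigma) :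
  ((fun N : nat => (2 * N)%:R^-1 * ln (Z N lambda sigma)) @ \oo
     --> Num.max (F lambda) (G sigma)) /\
  exists C1 : R, 0 < C1 /\
    (F lambda < G sigma -> forall N : nat, (1 <= N)%N ->
       C1^-1 <= Num.sqrt N%:R * Z N lambda sigma
                / expR (2 * N%:R * G sigma) <= C1) /\
    (G sigma <= F lambda -> 2 < lambda -> forall N : nat, (1 <= N)%N ->
       C1^-1 <= Z N lambda sigma / expR (2 * N%:R * F lambda) <= C1).
Proof.
have [FG|GF] := ltP (F lambda) (G sigma).
  split; first by exact: desorbed_rate.
  have [C C0 HC] := desorbed_asymptotics hlambda hsigma FG.
  by exists C; split=> //; split=> // GF; move: FG; rewrite ltNge GF.
have [l2|l2] := ltP 2 lambda.
  split; first by exact: pinned_rate.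
  have [C C0 HC] := pinned_asymptotics hsigma GF l2.
  by exists C; split=> //; split=> // FG; move: FG; rewrite ltNge GF.
have F0 : F lambda = 0 by rewrite /F ltNge l2.
split; last by exists 1; split=> //; split=> // FG; move: FG; rewrite ltNge GF.
have s0 : sigma = 0.
  apply/eqP; rewrite eq_le hsigma andbT leNgt; apply/negP => /G_gt0.
  by rewrite ltNge -F0 GF.
by rewrite F0 s0; apply: critical_rate; rewrite hlambda.
Qed.
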